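(* Let $G=(V,E)$ be a connected, locally finite, unimodular transitive graph with base point $o\in V$, let $X=(X_k)_{k\geq 0}$ be the simple random walk on $G$, let $d$ be the graph distance on $G$, and let $\Phi$ and $\Lambda$ denote the isoperimetric profile and spectral profile of $G$ respectively. Let $$c=\frac{\min\{\#(\operatorname{Aut}(G)e\cap E^\rightarrow_o): e\in E^\rightarrow\}}{2\deg(o)}.$$ Then for every pair of integers $k,r\geq 1$, $$\mathbb{P}\left(d(X_0,X_k)\leq r\right)\leq 2\exp\left[-\frac{\log 2}{2}\max\left\{\ell\geq 0:\ \frac{\ell\log 2}{\Lambda\left(2^{\ell+1}\Phi^{-1}(c/r)\right)}\leq k\right\}\right],$$ where the maximum is over non-negative integers $\ell$.
   Context: A graph is transitive if its automorphism group $\operatorname{Aut}(G)$ acts transitively on $V$. It is a unimodular transitive graph if, moreover, $\operatorname{Aut}(G)$ (a locally compact group in the topology of pointwise convergence) is unimodular, i.e. its left Haar measure is also right-invariant; equivalently, $|\operatorname{Stab}_x y|=|\operatorname{Stab}_y x|$ for all $x,y$ in the same orbit, where $\operatorname{Stab}_x$ is the stabilizer of $x$. Each edge is regarded as a pair of oriented edges in opposite directions. $E^\rightarrow$ is the set of oriented edges, $E^\rightarrow_o$ is the set of oriented edges emanating from $o$, and $\operatorname{Aut}(G)e$ is the orbit of $e$ under $\operatorname{Aut}(G)$. For a symmetric stochastic matrix $P$ on a countable set $V$, the isoperimetric profile is $$\Phi_P(n)=\inf\Big\{\frac{1}{|\Omega|}\sum_{x\in\Omega,\,y\in V\setminus\Omega}P(x,y):\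 \emptyset\neq\Omega\subset V,\ |\Omega|\leq n\Big\},$$ and the spectral profile is $\Lambda_P(n)=\inf\{\lambda_P(\Omega):\emptyset\neq\Omega\subset V,\ |\Omega|\leq n\}$, where $$\lambda_P(\Omega)=\inf\{\langle (I-P)f,f\rangle:\ \operatorname{support}(f)\subset\Omega,\ \|f\|_2=1\}$$ with $\ell^2(V)$ taken with respect to counting measure. These are defined for real $n\geq 1$. The profiles $\Phi,\Lambda$ of $G$ are those of its simple random walk transition matrix. For a decreasing function $f$, $f^{-1}(x)=\inf\{t: f(t)\leq x\}$. Conventions: if there is no $t$ with $\Phi(t)\leq c/r$, then $\Phi^{-1}(c/r)=\infty$ and the maximum is taken to be $0$ (so that the bound is trivial). The value $\ell=0$ always belongs to the set, and a ratio with $\ell\geq 1$ and zero denominator is $+\infty$. *)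

(* Defs.v *)
From HB Require Import structures.
From mathcomp Require Import all_boot all_order all_algebra finmap.
From mathcomp Require Import all_classical all_reals all_analysis.

Set Implicit Arguments.
Unset Strict Implicit.
Unset Printing Implicit Defensive.

Import Order.TTheory GRing.Theory Num.Theory.
Import numFieldNormedType.Exports.

Local Open Scope classical_set_scope.
Local Open Scope ring_scope.

Definition set_min (A : set nat) : nat := xget 0%N (A `&` lbound A).
Definition set_max (A : set nat) : nat := xget 0%N (A `&` ubound A).

Section graphs.
Context {V : choiceType}.
Implicit Types (E : rel V) (x y : V).

Definition simple_graph E := symmetric E /\ irreflexive E.

Definition graph_connected E :=
  forall x y, exists p : seq V, path E x p /\ last x p = y.

Definition locally_finite E := forall x, finite_set [set y | E x y].

Definition degree E x : nat := #|` fset_set [set y | E x y]|.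

Definition graph_dist E x y : nat :=
  set_min [set n | exists p : seq V, [/\ path E x p, last x p = y & size p = n]].

End graphs.

Section automorphisms.
Context {V : choiceType}.
Implicit Types E : rel V.

Definition aut_set E : set {ptws V -> discrete_topology V} :=
  [set g | bijective g /\ forall x y : V, E (g x) (g y) = E x y].

(* The topology is that of pointwise convergence: the subspace topology
   inherited from the product V -> V of copies of the discrete space V. *)
Definition Aut E : Type := set_type (aut_set E).

HB.instance Definition _ E := Topological.copy (Aut E) (set_type (aut_set E)).

Definition aut_fun E (g : Aut E) : V -> V := set_val g.

Lemma aut_id_subproof E : (id : V -> V) \in aut_set E.
Proof. by apply/mem_set; split => //; exists id. Qed.

Definition aut_id E : Aut E := SigSub (aut_id_subproof E).

HB.instance Definition _ E := isPointed.Build (Aut E) (aut_id E).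

Lemma aut_mul_subproof E (g h : Aut E) : aut_fun g \o aut_fun h \in aut_set E.
Proof.
have [bg Eg] := set_mem (valP g); have [bh Eh] := set_mem (valP h).
by apply/mem_set; split=> [|x y]; [exact: bij_comp | rewrite /= Eg Eh].
Qed.

Definition aut_mul E (g h : Aut E) : Aut E := SigSub (aut_mul_subproof g h).

Definition aut_borel E := g_sigma_algebraType (@open (Aut E)).

Definition vertex_transitive E :=
  forall x y, exists g : Aut E, aut_fun g x = y.

(* Translates are written as preimages: h |-> g h pulls A back to g^-1 A, and
   g ranges over the whole group. For a connected locally finite graph Aut E is
   locally compact, Hausdorff and second countable, so that a Borel measure
   which is finite on compact sets is automatically regular. *)
Definition left_haar (R : realType) E
    (mu : {measure set (aut_borel E) -> \bar R}) :=
  [/\ mu setT != 0%E,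
      forall K : set (Aut E), compact K -> (mu K < +oo)%E
    & forall (g : Aut E) (A : set (aut_borel E)), measurable A ->
        mu (aut_mul g @^-1` A) = mu A].

Definition right_invariant (R : realType) E
    (mu : {measure set (aut_borel E) -> \bar R}) :=
  forall (g : Aut E) (A : set (aut_borel E)), measurable A ->
    mu ((fun h => aut_mul h g) @^-1` A) = mu A.

(* Left Haar measure exists and is unique up to a positive factor, so the
   choice of mu is immaterial. *)
Definition unimodular (R : realType) E :=
  exists mu : {measure set (aut_borel E) -> \bar R},
    left_haar mu /\ right_invariant mu.

(* An oriented edge is the pair (tail, head). *)
Definition oriented_edges E : set (V * V) := [set e | E e.1 e.2].

Definition oriented_edges_from E (o : V) : set (V * V) :=
  [set e | oriented_edges E e /\ e.1 = o].

Definition edge_orbit E (e : V * V) : set (V * V) :=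
  [set (aut_fun g e.1, aut_fun g e.2) | g in [set: Aut E]].

Definition min_orbit_size E (o : V) : nat :=
  set_min [set #|` fset_set (edge_orbit E e `&` oriented_edges_from E o)|
          | e in oriented_edges E].

End automorphisms.

Section profiles.
Context {R : realType} {V : choiceType}.
Implicit Types (P : V -> V -> R) (Om : {fset V}) (f g : V -> R).

Definition isoperimetric_profile P (n : R) : \bar R :=
  ereal_inf [set ((#|` Om|%:R)^-1%:E *
                  \sum_(x <- Om) \esum_(y in ~` [set` Om]) (P x y)%:E)%E
            | Om in [set Om | Om != fset0 /\ #|` Om|%:R <= n]].

(* The sums over V below are sums over the finite support of the summand;
   they are used only for functions supported in a finite set. *)
Definition dotp f g : R := \sum_(x \in [set: V]) f x * g x.

Definition norm2 f : R := Num.sqrt (dotp f f).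

Definition apply_matrix P f : V -> R :=
  fun x => \sum_(y \in [set: V]) P x y * f y.

Definition lambda P Om : \bar R :=
  ereal_inf [set (dotp (fun x => f x - apply_matrix P f x) f)%:E
            | f in [set f | (forall x, f x != 0 -> x \in Om) /\ norm2 f = 1]].

Definition spectral_profile P (n : R) : \bar R :=
  ereal_inf [set lambda P Om
            | Om in [set Om | Om != fset0 /\ #|` Om|%:R <= n]].

End profiles.

(* The functions f considered here live on [1, +oo[; the value is +oo when f
   never goes below x. *)
Definition decr_inv (R : realType) (f : R -> \bar R) (x : R) : \bar R :=
  ereal_inf [set t%:E | t in [set t : R | 1 <= t /\ (f t <= x%:E)%E]].

Section random_walk.
Context (R : realType) {V : choiceType}.
Implicit Types E : rel V.

Definition srw_matrix E (x y : V) : R :=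
  if E x y then (degree E x)%:R^-1 else 0.

(* A Markov chain with transition matrix p and arbitrary initial law; V is
   understood to be countable with its discrete sigma-algebra. *)
Definition markov_chain (p : V -> V -> R) (d : measure_display)
    (T : measurableType d) (Pr : probability T R) (X : nat -> T -> V) :=
  (forall n x, measurable (X n @^-1` [set x])) /\
  (forall n (x : nat -> V),
     Pr [set w | forall i, (i <= n.+1)%N -> X i w = x i] =
     (Pr [set w | forall i, (i <= n)%N -> X i w = x i] *
      (p (x n) (x n.+1))%:E)%E).

Definition simple_random_walk E (d : measure_display)
    (T : measurableType d) (Pr : probability T R) (X : nat -> T -> V) :=
  markov_chain (srw_matrix E) Pr X.

Definition edge_constant E (o : V) : R :=
  (min_orbit_size E o)%:R / (2 * (degree E o)%:R).

(* On \bar R one has 0^-1 = +oo, 0 * +oo = 0 and a * +oo = +oo for a > 0, so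
   when the spectral profile vanishes the ratio is 0 for l = 0 and +oo for
   l >= 1. *)
Definition max_exponent E (s : R) (k : nat) : nat :=
  if decr_inv (isoperimetric_profile (srw_matrix E)) s is t%:E then
    set_max [set l : nat |
      ((l%:R * ln 2)%:E / spectral_profile (srw_matrix E) (2 ^+ l.+1 * t)
         <= k%:R%:E)%E]
  else 0%N.

End random_walk.

(* Main.v *)
(** Take a finite set [Om] with [#|Om| <= Phi^-1(c/r)] and isoperimetric ratio at
    most [c/r] (the infimum defining the profile is attained). Let [g] be an
    automorphism chosen by Haar measure conditioned on [g o \in Om]. For an edge
    [(a, b)], unimodularity bounds the mass of [g a \in Om, g b \notin Om] by the
    number of boundary edges of [Om] over the size of an edge orbit at [o].
    Summing along a path of length at most [r] from [o] to [z] shows that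
    [g z \in Om] with probability at least 1/2. As the kernel [p_k] is invariant,
    this gives
      [P(d(X_0, X_k) <= r) <= 2 / #|Om| * \sum_(x, y in Om) p_k(x, y)].
    The right-hand side is [2 <P^k f, f> / #|Om|] with [f] the indicator of [Om],
    and is bounded by the spectral profile: truncating [P^j f] and [P^j.+1 f] at
    height [2^-l] leaves functions supported on at most [2^l.+1 * #|Om|] points.
    Working with the pair, i.e. on the bipartite double cover, makes the negative
    spectrum of [P] harmless. *)

Require Import Defs.
From mathcomp Require Import all_boot all_order all_algebra finmap.
From mathcomp Require Import all_classical all_reals all_analysis.
From mathcomp Require Import lra.

Set Implicit Arguments.
Unset Strict Implicit.
Unset Printing Implicit Defensive.

Import Order.TTheory GRing.Theory Num.Theory.
Import numFieldNormedType.Exports.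

Local Open Scope classical_set_scope.
Local Open Scope ring_scope.

(** * Decay of return probabilities under a Faber-Krahn inequality *)

Section faber_krahn_decay.
Context {R : realFieldType} {I : finType} (Q : I -> I -> R).
Implicit Types (f g h u v w : I -> R) (A : {set I}) (tau : R).

Definition scal f g : R := \sum_x f x * g x.
Definition sqn f : R := \sum_x f x ^+ 2.
Definition ind A : I -> R := fun x => (x \in A)%:R.
Definition op f : I -> R := fun x => \sum_y Q x y * f y.
Definition trunc (tau : R) f : I -> R := fun x => Num.max (f x - tau) 0.

Lemma scalC f g : scal f g = scal g f.
Proof. by apply: eq_bigr => x _; rewrite mulrC. Qed.

Lemma sqnE f : sqn f = scal f f.
Proof. by apply: eq_bigr => x _; rewrite expr2. Qed.

Lemma scal_op f g : scal (op f) g = \sum_x \sum_y Q x y * (f y * g x).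
Proof.
by apply: eq_bigr => x _; rewrite /op mulr_suml; apply: eq_bigr => y _; lra.
Qed.

Hypothesis Q_sym : forall x y, Q x y = Q y x.
Hypothesis Q_ge0 : forall x y, 0 <= Q x y.
Hypothesis Q_sub : forall x, \sum_y Q x y <= 1.

Lemma scal_op_sym f g : scal (op f) g = scal f (op g).
Proof.
rewrite [RHS]scalC !scal_op exchange_big; apply: eq_bigr => x _.
by apply: eq_bigr => y _; rewrite Q_sym mulrC [f x * g y]mulrC mulrC.
Qed.

Lemma op_ge0 f : (forall x, 0 <= f x) -> forall x, 0 <= op f x.
Proof. by move=> f0 x; apply: sumr_ge0 => y _; rewrite mulr_ge0. Qed.

Lemma sum_op_le f : (forall x, 0 <= f x) -> \sum_x op f x <= \sum_x f x.
Proof.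
move=> f0; rewrite exchange_big /=; apply: ler_sum => y _.
rewrite -mulr_suml ler_piMl //.
by rewrite (eq_bigr (fun x => Q y x)) // => x _; rewrite Q_sym.
Qed.

(* The Dirichlet form of the pair [(g, h)] for the walk on the bipartite double
   cover, written as a sum of squares plus a killing term. *)
Lemma double_dirichletE g h :
  sqn g + sqn h - 2 * scal (op g) h =
  \sum_x (1 - \sum_y Q x y) * (g x ^+ 2 + h x ^+ 2) +
  \sum_x \sum_y Q x y * (g y - h x) ^+ 2.
Proof.
have -> : \sum_x \sum_y Q x y * (g y - h x) ^+ 2 =
  \sum_x \sum_y Q x y * g y ^+ 2 +
  (\sum_x \sum_y Q x y * h x ^+ 2 - 2 * scal (op g) h).
  rewrite scal_op mulr_sumr -sumrB -big_split; apply: eq_bigr => x _ /=.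
  rewrite mulr_sumr -sumrB -big_split; apply: eq_bigr => y _ /=; lra.
have -> : \sum_x \sum_y Q x y * g y ^+ 2 = \sum_x (\sum_y Q x y) * g x ^+ 2.
  rewrite exchange_big; apply: eq_bigr => y _ /=.
  by rewrite mulr_suml; apply: eq_bigr => x _; rewrite Q_sym.
have -> : \sum_x \sum_y Q x y * h x ^+ 2 = \sum_x (\sum_y Q x y) * h x ^+ 2.
  by apply: eq_bigr => x _; rewrite mulr_suml.
rewrite !addrA /sqn -!big_split /=; congr (_ - _).
by apply: eq_bigr => x _; lra.
Qed.

Lemma truncP tau f x :
  (trunc tau f x = f x - tau /\ tau <= f x) \/ (trunc tau f x = 0 /\ f x <= tau).
Proof.
rewrite /trunc; have [le0|gt0] := leP (f x - tau) 0; [right|left]; split => //.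
  by rewrite -subr_le0.
by rewrite -subr_ge0 ltW.
Qed.

(** By [double_dirichletE] the form is a sum of squares with non-negative weights; truncation is
    1-Lipschitz and fixes [0], so no square grows. *)
Lemma double_dirichlet_trunc tau g h : 0 <= tau ->
  (forall x, 0 <= g x) -> (forall x, 0 <= h x) ->
  sqn (trunc tau g) + sqn (trunc tau h) - 2 * scal (op (trunc tau g)) (trunc tau h)
  <= sqn g + sqn h - 2 * scal (op g) h.
Proof.
move=> tau0 g0 h0; rewrite !double_dirichletE; apply: lerD; apply: ler_sum => x _.
  apply: ler_wpM2l; first by rewrite subr_ge0.
  have sq f : (forall y, 0 <= f y) -> trunc tau f x ^+ 2 <= f x ^+ 2.
    by move=> /(_ x) f0; case: (truncP tau f x) => [[-> ?]|[-> ?]]; nra.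
  by apply: lerD; apply: sq.
apply: ler_sum => y _; apply: ler_wpM2l => //.
have cross (a b : R) : b <= tau -> tau <= a -> (a - tau) ^+ 2 <= (a - b) ^+ 2.
  by move=> bt ta; apply: lerXn2r; rewrite ?nnegrE ?subr_ge0 ?(le_trans bt) // lerD2l lerN2.
case: (truncP tau g y) => [[-> tg]|[-> gt]];
  case: (truncP tau h x) => [[-> th]|[-> ht]].
- by rewrite le_eqVlt; apply/orP; left; apply/eqP; lra.
- by rewrite subr0 cross.
- by rewrite sub0r sqrrN [leRHS](_ : _ = (h x - g y) ^+ 2) ?cross//; lra.
- by rewrite subrr expr0n sqr_ge0.
Qed.

(** Pointwise: below the level [f ^+ 2 - 2 * tau * f] is non-positive, above it the two sides differ
    by [tau ^+ 2]. *)
Lemma sqn_trunc_ge tau f : 0 <= tau -> (forall x, 0 <= f x) ->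
  sqn f - 2 * tau * \sum_x f x <= sqn (trunc tau f).
Proof.
move=> tau0 f0; rewrite mulr_sumr -sumrB; apply: ler_sum => x _.
by have := f0 x; case: (truncP tau f x) => [[-> ?]|[-> ?]]; nra.
Qed.

Variables (n : nat) (lam : R).
Hypothesis faber_krahn : forall A f, (#|A| <= n)%N ->
  (forall x, x \notin A -> f x = 0) -> lam * sqn f <= sqn f - scal (op f) f.

(* Polarisation; the sign of [u - v] is removed using the positivity of [Q], so
   the bottom of the spectrum of [Q] plays no role. *)
Lemma double_faber_krahn A u v : (#|A| <= n)%N ->
  (forall x, x \notin A -> u x = 0) -> (forall x, x \notin A -> v x = 0) ->
  lam * (sqn u + sqn v) <= sqn u + sqn v - 2 * scal (op u) v.
Proof.
move=> An uA vA.
have := @faber_krahn A (fun x => u x + v x) An.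
have := @faber_krahn A (fun x => `|u x - v x|) An.
have h1 x : x \notin A -> `|u x - v x| = 0 by move=> xA; rewrite uA// vA// subrr normr0.
have h2 x : x \notin A -> u x + v x = 0 by move=> xA; rewrite uA// vA// addr0.
move=> /(_ h1) H1 /(_ h2) H2.
have e1 : sqn (fun x => u x + v x) + sqn (fun x => `|u x - v x|) = 2 * (sqn u + sqn v).
  rewrite /sqn -!big_split mulr_sumr; apply: eq_bigr => x _ /=.
  by rewrite real_normK ?num_real//; lra.
have e2 : 4 * scal (op u) v <= scal (op (fun x => u x + v x)) (fun x => u x + v x) +
   scal (op (fun x => `|u x - v x|)) (fun x => `|u x - v x|).
  have -> : 4 * scal (op u) v = 2 * scal (op u) v + 2 * scal (op v) u.
    by rewrite [scal (op v) u]scal_op_sym [scal v _]scalC; lra.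
  rewrite !scal_op !mulr_sumr -!big_split; apply: ler_sum => x _ /=.
  rewrite !mulr_sumr -!big_split; apply: ler_sum => y _ /=.
  have := ler_norm (- ((u y - v y) * (u x - v x))); rewrite normrN normrM.
  have := Q_ge0 x y; nra.
nra.
Qed.

(** Truncating at [tau] does not increase the form, costs at most [2 * tau] times the total mass in
    squared norm, and leaves a pair supported where [g] or [h] exceeds [tau]. Faber-Krahn applies to
    the truncated pair. *)
Lemma double_decay tau g h : 0 < tau -> 0 <= lam ->
  (forall x, 0 <= g x) -> (forall x, 0 <= h x) ->
  \sum_x g x + \sum_x h x <= n%:R * tau ->
  lam * (sqn g + sqn h - 2 * tau * (\sum_x g x + \sum_x h x)) <=
  sqn g + sqn h - 2 * scal (op g) h.
Proof.
move=> tau0 lam0 g0 h0 small.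
pose A : {set I} := finset (fun x => (tau < g x) || (tau < h x)).
(* Markov's inequality: [tau <= g x + h x] on [A]. *)
have An : (#|A| <= n)%N.
  rewrite -(ler_nat R) -(ler_pM2r tau0); apply: le_trans small.
  rewrite -sum1_card natr_sum mulr_suml -big_split /= [leRHS](bigID (mem A)) /=.
  rewrite ler_wpDr//; first by apply: sumr_ge0 => x _; rewrite addr_ge0.
  apply: ler_sum => x; rewrite finset.in_set mul1r.
  by have := g0 x; have := h0 x => ? ? /orP[]; nra.
have trA f : (forall x, tau < f x -> x \in A) ->
    forall x, x \notin A -> trunc tau f x = 0.
  move=> fA x xA; apply/max_idPr; rewrite subr_le0 leNgt.
  by apply: contra xA => /fA.
apply: le_trans (double_dirichlet_trunc (ltW tau0) g0 h0).
have gA x : tau < g x -> x \in A by rewrite finset.in_set => ->.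
have hA x : tau < h x -> x \in A by rewrite finset.in_set orbC => ->.
apply: le_trans (double_faber_krahn An (trA g gA) (trA h hA)).
apply: ler_wpM2l => //.
by have := sqn_trunc_ge (ltW tau0) g0; have := sqn_trunc_ge (ltW tau0) h0; nra.
Qed.

Fixpoint iterop_fun (j : nat) f : I -> R :=
  if j is j'.+1 then op (iterop_fun j' f) else f.

Lemma scal_iterop j f g : scal (iterop_fun j f) g = scal f (iterop_fun j g).
Proof.
elim: j g => //= j IH g; rewrite scal_op_sym IH; congr scal => {IH}.
by elim: j => //= j ->.
Qed.

Lemma iterop_add i j f : iterop_fun i (iterop_fun j f) = iterop_fun (i + j) f.
Proof. by elim: i => //= i ->. Qed.

(** Truncation takes place at level [x]. Two time steps contract the return sum minus [2 * x * #|A|]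
    by [(1 - lam) / (1 + lam)], which [rho ^+ 2] dominates; an odd time adds a last factor
    [1 - lam], which [rho] dominates. *)
Lemma return_decay (A : {set I}) (x rho : R) (k : nat) :
  0 < x -> 2 * x <= 1 -> 0 <= lam <= 1 -> 2 * #|A|%:R <= n%:R * x ->
  0 <= rho -> 1 - lam <= rho -> 1 - lam <= rho ^+ 2 * (1 + lam) ->
  scal (iterop_fun k (ind A)) (ind A) <= #|A|%:R * (2 * x + (1 - 2 * x) * rho ^+ k).
Proof.
move=> x0 x1 /andP[lam0 lam1] small rho0 rho1 rho2; set f0 := ind A.
pose w : R := #|A|%:R.
have w0 : 0 <= w by [].
have sf0 : \sum_y f0 y = w.
  by rewrite /w /f0 /ind -sum1_card natr_sum [RHS]big_mkcond; apply: eq_bigr => y _; case: (_ \in _).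
pose F j := iterop_fun j f0.
have F0 j y : 0 <= F j y by elim: j y => [|j IH] y; [rewrite ler0n|exact: op_ge0].
have SF j : \sum_y F j y <= w.
  by elim: j => [|j IH]; [rewrite sf0|exact: le_trans (sum_op_le (F0 j)) IH].
have a2 j : scal (F j.*2) f0 = sqn (F j).
  by rewrite -addnn /F -iterop_add scal_iterop sqnE.
have a3 j : scal (F j.*2.+1) f0 = scal (op (F j)) (F j).
  by rewrite -addnn -addnS /F -iterop_add scal_iterop scalC.
have even j : sqn (F j) - 2 * x * w <= (1 - 2 * x) * w * (rho ^+ 2) ^+ j.
  elim: j => [|j IH].
    rewrite expr0 mulr1 mulrBl mul1r lerD2r sqnE -sf0; apply: ler_sum => y _.
    by rewrite /F /f0 /ind /=; case: (_ \in _); rewrite ?mulr0 ?mulr1.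
  (* For this pair the cross term is the squared norm of [F j.+1], so the form is the difference of
     two consecutive squared norms. *)
  have := double_decay x0 lam0 (F0 j) (F0 j.+1).
  rewrite /= -/(F j) -sqnE.
  have s1 := SF j; have s2 := SF j.+1; rewrite /= -/(F j) in s2.
  move=> /(_ _)H; have {}H := H ltac:(rewrite /w in s1 s2; lra).
  have lx0 : 0 <= lam * x by rewrite mulr_ge0// ltW.
  have {}H : (1 + lam) * (sqn (F j.+1) - 2 * x * w) <= (1 - lam) * (sqn (F j) - 2 * x * w).
    by rewrite /= -/(F j); nra.
  have l1 : 0 < 1 + lam by lra.
  rewrite -(ler_pM2l l1); apply: le_trans H _.
  rewrite exprS.
  set B := (1 - 2 * x) * w * _ in IH *.
  have B0 : 0 <= B by rewrite /B !mulr_ge0 ?exprn_ge0 //; lra.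
  have -> : (1 + lam) * ((1 - 2 * x) * w * (rho ^+ 2 * rho ^+ 2 ^+ j)) = rho ^+ 2 * (1 + lam) * B.
    by rewrite /B; lra.
  apply: le_trans (_ : (1 - lam) * B <= _); last exact: ler_wpM2r.
  by apply: ler_wpM2l => //; lra.
rewrite -/(F k) -(odd_double_half k) mulrDr; case: (odd k) => /=; last first.
  rewrite add0n a2 -mul2n exprM; have := even k./2; rewrite -/w; lra.
rewrite add1n a3 -mul2n exprS exprM.
(* The last step of an odd time pairs [F k./2] with itself, which gives twice the ordinary Dirichlet
   form. *)
have := double_decay x0 lam0 (F0 k./2) (F0 k./2); have s1 := SF k./2.
move=> /(_ _)H; have {}H := H ltac:(rewrite /w in s1; lra).
have := even k./2; set B := (_ ^+ _ ^+ _) => E1.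
have B0 : 0 <= B by rewrite /B !exprn_ge0.
have lx0 : 0 <= lam * x by rewrite mulr_ge0// ltW.
have H2 : scal (op (F k./2)) (F k./2) - 2 * x * w <= (1 - lam) * (sqn (F k./2) - 2 * x * w).
  nra.
have E2 : (1 - lam) * (sqn (F k./2) - 2 * x * w) <= rho * ((1 - 2 * x) * w * B).
  apply: le_trans (_ : (1 - lam) * ((1 - 2 * x) * w * B) <= _).
    by apply: ler_wpM2l E1; lra.
  by apply: ler_wpM2r rho1; rewrite !mulr_ge0//; lra.
by rewrite -/w; lra.
Qed.

End faber_krahn_decay.

(** * Elementary inequalities for the exponential *)

Section exponentials.
Context {R : realType}.
Implicit Types s t x lam : R.

(** For [t < 1] this is [t <= artanh t]; it makes [expR (- lam)] an admissible [rho] in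
    [return_decay]. After multiplication by [expR t] the difference of the sides is [f], which
    vanishes at [0] and has a non-negative derivative. *)
Lemma le_expRN2 t : 0 <= t -> 1 - t <= expR (- t) ^+ 2 * (1 + t).
Proof.
move=> t0.
pose f x : R := (1 + x) * expR (- x) - (1 - x) * expR x.
have df x : is_derive x 1 f (x * (expR x - expR (- x))).
  by apply: is_derive_eq; rewrite /GRing.scale /=; lra.
have : f 0 <= f t.
  apply: (@ger0_derive1_ndecry R f 0) => //.
  - move=> x; rewrite in_itv /= andbT => x0.
    rewrite derive1E derive_val; apply: mulr_ge0; first exact: ltW.
    rewrite subr_ge0 ler_expR; lra.
  - by apply: derivable_within_continuous => x _.
have -> : f 0 = 0 by rewrite /f oppr0 expR0; lra.
rewrite /f subr_ge0 => H; have e0 := expR_gt0 (- t).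
have : (1 - t) * expR t * expR (- t) <= (1 + t) * expR (- t) * expR (- t).
  by rewrite ler_pM2r.
rewrite -mulrA expRxMexpNx_1; lra.
Qed.

Lemma expR_half_ln2 (l : nat) : expR (- (ln 2 / 2 * l%:R)) ^+ 2 = 2^-1 ^+ l :> R.
Proof.
rewrite -expRM_natl -[X in X ^+ l](@lnK R 2^-1) ?posrE// -expRM_natl lnV ?posrE//.
by congr expR; lra.
Qed.

(* With [x = 2^-l], [2 x + (1 - 2 x) x <= sqrt x] holds for [x <= 1/8] but fails
   at [x = 1/4]. *)
Lemma decay_to_sqrt (l : nat) : (3 <= l)%N ->
  2 * 2^-1 ^+ l + (1 - 2 * 2^-1 ^+ l) * 2^-1 ^+ l <= expR (- (ln 2 / 2 * l%:R)) :> R.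
Proof.
move=> l3; set x := 2^-1 ^+ l; have := expR_half_ln2 l; rewrite -/x.
set s := expR _ => sx; have s0 : 0 < s by exact: expR_gt0.
have x8 : x <= 8^-1.
  have -> : 8^-1 = 2^-1 ^+ 3 :> R by rewrite !exprS expr0; lra.
  by apply: ler_wiXn2l => //; lra.
have s38 : s <= 3 / 8.
  rewrite leNgt; apply/negP => ?; nra.
rewrite -sx.
(* With [x = s ^+ 2] the gap between the sides is [s - 3 s^2 + 2 s^4], which factors like this. The
   last factor is non-negative because [s <= 3/8] and [s ^+ 2 <= 1/8]. *)
have : 0 <= s * ((1 - s) * (1 - 2 * s - 2 * s ^+ 2)).
  by apply: mulr_ge0; [lra|apply: mulr_ge0; [lra|nra]].
nra.
Qed.

Lemma expR_rate lam (k l : nat) : l%:R * ln 2 <= k%:R * lam ->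
  expR (- lam) ^+ k <= 2^-1 ^+ l.
Proof.
move=> H; rewrite -expRM_natl -[X in X ^+ l](@lnK R 2^-1) ?posrE// -expRM_natl.
by rewrite lnV ?posrE// ler_expR; lra.
Qed.

(** Covers the exponents left out of [decay_to_sqrt]: there the factor two alone makes the final
    bound trivial. *)
Lemma small_exponent (l : nat) : (l <= 2)%N -> 1 <= 2 * expR (- (ln 2 / 2 * l%:R)) :> R.
Proof.
move=> l2; have := expR_half_ln2 l.
set s := expR _ => sx; have s0 : 0 < s by exact: expR_gt0.
have x4 : 4^-1 <= (2^-1 : R) ^+ l.
  have -> : 4^-1 = 2^-1 ^+ 2 :> R by rewrite !exprS expr0; lra.
  by apply: ler_wiXn2l => //; lra.
nra.
Qed.

End exponentials.

(** * Profiles *)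

Section spectral_interface.
Context {R : realType} {V : choiceType}.
Implicit Types (P : V -> V -> R) (f : V -> R) (A W : {fset V}).
Local Open Scope fset_scope.

Lemma dirichlet_finsum P f W : (forall x, x \notin W -> f x = 0) ->
  dotp (fun x => f x - apply_matrix P f x) f =
  \sum_(x <- W) f x ^+ 2 - \sum_(x <- W) (\sum_(y <- W) P x y * f y) * f x.
Proof.
move=> fW; rewrite /dotp (fsbigTE W); last by move=> x /fW ->; rewrite mulr0.
rewrite -sumrB; apply: eq_bigr => x _; rewrite /apply_matrix (fsbigTE W).
  by rewrite mulrBl expr2.
by move=> y /fW ->; rewrite mulr0.
Qed.

Lemma norm2_finsum f W : (forall x, x \notin W -> f x = 0) ->
  norm2 f = Num.sqrt (\sum_(x <- W) f x ^+ 2).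
Proof.
move=> fW; rewrite /norm2 /dotp (fsbigTE W); last by move=> x /fW ->; rewrite mulr0.
by congr Num.sqrt; apply: eq_bigr => x _; rewrite expr2.
Qed.

(** By homogeneity: [f] divided by its norm competes in [lambda P A]. Summing over a window [W]
    around [A] lets one finite matrix serve for all [A]. *)
Lemma spectral_profile_faber_krahn P (n lam : R) A W f :
  (lam%:E <= spectral_profile P n)%E -> A `<=` W -> #|` A|%:R <= n ->
  (forall x, x \notin A -> f x = 0) ->
  lam * \sum_(x <- W) f x ^+ 2 <=
  \sum_(x <- W) f x ^+ 2 - \sum_(x <- W) (\sum_(y <- W) P x y * f y) * f x.
Proof.
move=> lamP /fsubsetP AW An fA.
have fW x : x \notin W -> f x = 0 by move=> xW; apply: fA; apply: contra xW => /AW.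
(* A function of norm zero cannot be normalised, but then both sides vanish. *)
have [N0|N0] := eqVneq (\sum_(x <- W) f x ^+ 2) 0.
  have f0 x : x \in W -> f x = 0.
    move=> xW; apply/eqP; rewrite -sqrf_eq0 -[_ == _]implyTb.
    move/eqP: N0; rewrite psumr_eq0; last by move=> y _; rewrite sqr_ge0.
    by move=> /allP /(_ x xW).
  rewrite N0 mulr0 sub0r oppr_ge0 big_seq big1// => x xW.
  by rewrite (f0 x xW) mulr0.
set N := \sum_(x <- W) f x ^+ 2 in N0 *.
have {}N0 : 0 < N by rewrite lt_neqAle eq_sym N0 sumr_ge0// => x _; rewrite sqr_ge0.
pose s := Num.sqrt N; have s0 : 0 < s by rewrite sqrtr_gt0.
have sN : s ^+ 2 = N by rewrite sqr_sqrtr// ltW.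
pose g x := f x / s.
have gW x : x \notin W -> g x = 0 by move=> /fW; rewrite /g => ->; rewrite mul0r.
have An0 : A != fset0.
  apply: contraTneq N0 => A0; rewrite -leNgt /N big1// => x _.
  by rewrite fA ?A0 ?inE// expr0n.
have : (lam%:E <= (dotp (fun x => g x - apply_matrix P g x) g)%:E)%E.
  apply: le_trans lamP _; apply: le_trans (ereal_inf_lbound _) _.
    by exists A.
  apply: ereal_inf_lbound; exists g => //; split.
    by move=> x; apply: contra_neqT => /fA; rewrite /g => ->; rewrite mul0r.
  rewrite (norm2_finsum gW) -[RHS]sqrtr1; congr Num.sqrt.
  under eq_bigr do rewrite /g expr_div_n.
  by rewrite -mulr_suml sN divff// gt_eqF.
rewrite lee_fin (dirichlet_finsum P gW) -(ler_pM2r N0) => /le_trans; apply.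
rewrite le_eqVlt; apply/orP; left; apply/eqP.
rewrite mulrBl !mulr_suml; congr (_ - _); apply: eq_bigr => x _.
  by rewrite /g expr_div_n sN divfK// gt_eqF.
have -> : \sum_(y <- W) P x y * g y = (\sum_(y <- W) P x y * f y) / s.
  by rewrite mulr_suml; apply: eq_bigr => y _; rewrite mulrA.
by rewrite /g mulrACA -invfM -expr2 sN divfK// gt_eqF.
Qed.

End spectral_interface.

(** * Transitive graphs *)

(** For a non-empty set the default value of [xget] is never taken. *)
Lemma set_minP (A : set nat) : A !=set0 ->
  A (set_min A) /\ forall n, A n -> (set_min A <= n)%N.
Proof.
move=> [n0 An0].
have ex : exists n, `[< A n >] by exists n0; apply/asboolP.
have [] : (A `&` lbound A) (set_min A).
  rewrite /set_min; case: xgetP => [y -> []//|/(_ (ex_minn ex)) []].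
  case: ex_minnP => m /asboolP Am mmin; split => // n An.
  by apply: mmin; apply/asboolP.
by move=> ? lb; split => // n An; apply: lb.
Qed.

Section graph.
Context {V : choiceType} (E : rel V).
Implicit Types (x y z : V) (g : Aut E).
Local Open Scope fset_scope.

Lemma aut_edge g x y : E (aut_fun g x) (aut_fun g y) = E x y.
Proof. by have [_ ->] := set_mem (valP g). Qed.

Lemma aut_bij g : bijective (aut_fun g).
Proof. by have [] := set_mem (valP g). Qed.

Lemma aut_inj g : injective (aut_fun g).
Proof. exact: bij_inj (aut_bij g). Qed.

Lemma aut_mulE g h x : aut_fun (aut_mul g h) x = aut_fun g (aut_fun h x).
Proof. by []. Qed.

Definition nbr x : {fset V} := fset_set [set y | E x y].

Hypothesis E_simple : simple_graph E.
Hypothesis E_locally_finite : locally_finite E.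

Lemma in_nbr x y : (y \in nbr x) = E x y.
Proof. by rewrite in_fset_set//; apply/idP/idP; rewrite inE. Qed.

Lemma nbr_aut g x : nbr (aut_fun g x) = [fset aut_fun g y | y in nbr x].
Proof.
apply/fsetP => y; apply/idP/imfsetP => [|[z /=]]; rewrite !in_nbr.
  have [h gh hg] := aut_bij g.
  by rewrite -{1}(hg y) aut_edge => xhy; exists (h y); rewrite ?in_nbr.
by move=> xz ->; rewrite aut_edge.
Qed.

Lemma degree_nbr x : degree E x = #|` nbr x|.
Proof. by []. Qed.

Lemma degree_aut g x : degree E (aut_fun g x) = degree E x.
Proof. by rewrite !degree_nbr nbr_aut card_imfset//=; exact: aut_inj. Qed.

(** Recursion on the first step of a path makes balls finite by construction; [graph_dist_ball] ties
    them to the distance. *)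
Fixpoint ball (n : nat) x : {fset V} :=
  if n is n'.+1 then x |` \bigcup_(z <- nbr x) ball n' z else [fset x].

Lemma in_ball n x y :
  reflect (exists p : seq V, [/\ path E x p, last x p = y & (size p <= n)%N])
          (y \in ball n x).
Proof.
elim: n x => [|n IH] x /=.
  rewrite inE; apply: (iffP eqP) => [->|[p [_ <-]]]; first by exists [::].
  by rewrite leqn0 size_eq0 => /eqP ->.
rewrite 2!inE; apply: (iffP orP) => [[/eqP ->|/bigfcupP[z]]|[[|z p] /= [+ lp sp]]].
- by exists [::].
- rewrite andbT in_nbr => xz /IH[p [pp lp sp]].
  by exists (z :: p); split; rewrite //= xz.
- by left; rewrite lp.
- move=> /andP[xz pp]; right; apply/bigfcupP; exists z; rewrite ?andbT ?in_nbr//.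
  by apply/IH; exists p.
Qed.

Lemma ball_self n x : x \in ball n x.
Proof. by apply/in_ball; exists [::]. Qed.

Lemma ball_sub_nbr n x z : E x z -> ball n z `<=` ball n.+1 x.
Proof.
move=> xz; apply/fsubsetP => y /in_ball[p [pp lp sp]].
by apply/in_ball; exists (z :: p); split; rewrite //= xz.
Qed.

Lemma edge_sym x y : E x y = E y x.
Proof. by have [->] := E_simple. Qed.

Lemma ball_aut g n x : ball n (aut_fun g x) = [fset aut_fun g y | y in ball n x].
Proof.
elim: n x => [|n IH] x /=.
  by apply/fsetP => y; rewrite inE; apply/eqP/imfsetP => [->|[z /=]];
    [exists x; rewrite ?inE|rewrite inE => /eqP -> ->].
apply/fsetP => y; apply/idP/imfsetP => [|[z /=]].
  rewrite 2!inE => /orP[/eqP ->|]; first by exists x; rewrite // 2!inE eqxx.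
  move=> /bigfcupP[z]; rewrite andbT nbr_aut => /imfsetP[w /= xw ->].
  rewrite IH => /imfsetP[v /= vw ->]; exists v => //.
  by rewrite 2!inE; apply/orP; right; apply/bigfcupP; exists w; rewrite ?xw.
rewrite 2!inE => /orP[/eqP -> ->|]; first by rewrite 2!inE eqxx.
move=> /bigfcupP[w]; rewrite andbT => xw zw ->; rewrite 2!inE; apply/orP; right.
apply/bigfcupP; exists (aut_fun g w); rewrite ?andbT; last first.
  by rewrite IH; apply/imfsetP; exists z.
by rewrite nbr_aut; apply/imfsetP; exists w.
Qed.

Hypothesis E_connected : graph_connected E.

Lemma graph_dist_ball n x y : (graph_dist E x y <= n)%N = (y \in ball n x).
Proof.
rewrite /graph_dist; set A := [set m | _].
have [|[p [pp lp sp]] Amin] := @set_minP A.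
  by have [p [pp lp]] := E_connected x y; exists (size p), p.
apply/idP/in_ball => [le_n|[q [pq lq sq]]]; first by exists p; split; rewrite // sp.
by apply: leq_trans sq; apply: Amin; exists q.
Qed.

(** Connectedness exhausts the vertices by finite balls. Countability allows events, and the
    automorphism group, to be split according to the value of a vertex. *)
Lemma graph_countable (o : V) : countable [set: V].
Proof.
have -> : [set: V] = \bigcup_n [set` ball n o].
  apply/seteqP; split => // x _; have [p [pp lp]] := E_connected o x.
  by exists (size p) => //; apply/in_ball; exists p.
by apply: bigcup_countable => // n _; apply: finite_set_countable; exact: finite_fset.
Qed.

Hypothesis E_transitive : vertex_transitive E.

Lemma degree_const x y : degree E x = degree E y.
Proof. by have [g <-] := E_transitive y x; rewrite degree_aut. Qed.

Context {R : realType}.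
Notation P := (srw_matrix R E).

Lemma srw_sym x y : P x y = P y x.
Proof. by rewrite /srw_matrix edge_sym (degree_const x y). Qed.

Lemma srw_ge0 x y : 0 <= P x y.
Proof. by rewrite /srw_matrix; case: ifP. Qed.

Lemma srw_aut g x y : P (aut_fun g x) (aut_fun g y) = P x y.
Proof. by rewrite /srw_matrix aut_edge degree_aut. Qed.

Lemma srw_sum_nbr (f : V -> R) (W : {fset V}) x : nbr x `<=` W ->
  \sum_(y <- nbr x) P x y * f y = \sum_(y <- W) P x y * f y.
Proof.
move=> xW; apply: big_fset_incl => // y _.
by rewrite in_nbr /srw_matrix => /negbTE ->; rewrite mul0r.
Qed.

Lemma srw_sum_le1 (W : {fset V}) x : \sum_(y <- W) P x y <= 1.
Proof.
rewrite /srw_matrix -big_mkcond /= big_const_seq iter_addr_0 -[leLHS]mulr_natl.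
have cd : (count (E x) W <= degree E x)%N.
  rewrite -size_filter degree_nbr uniq_leq_size ?filter_uniq//.
  by move=> y; rewrite mem_filter in_nbr => /andP[].
have [->|d0] := eqVneq (degree E x) 0%N; first by rewrite invr0 mulr0.
by rewrite ler_pdivrMr ?ltr0n ?lt0n// mul1r ler_nat.
Qed.

(** The [n]-step transition probabilities; summing over neighbours only keeps every sum finite. *)
Fixpoint kernel (n : nat) x y : R :=
  if n is n'.+1 then \sum_(z <- nbr x) P x z * kernel n' z y else (x == y)%:R.

Lemma kernel_ge0 n x y : 0 <= kernel n x y.
Proof.
elim: n x => [|n IH] x /=; first by rewrite ler0n.
by apply: sumr_ge0 => z _; rewrite mulr_ge0 ?srw_ge0.
Qed.

Lemma kernel_sum_le1 n x (B : {fset V}) : \sum_(y <- B) kernel n x y <= 1.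
Proof.
elim: n x => [|n IH] x /=.
  have [xB|xB] := boolP (x \in B).
    by rewrite (big_fsetD1 x)//= eqxx big1_fset ?addr0// => y;
      rewrite !inE eq_sym => /andP[/negbTE ->].
  by rewrite big1_fset// => y yB _; case: eqVneq => // xy; rewrite xy yB in xB.
rewrite exchange_big /=; apply: le_trans (srw_sum_le1 (nbr x) x).
apply: ler_sum => z _; rewrite -mulr_sumr.
by apply: ler_piMr => //; exact: srw_ge0.
Qed.

Lemma kernel_aut g n x y : kernel n (aut_fun g x) (aut_fun g y) = kernel n x y.
Proof.
elim: n x => [|n IH] x /=; first by rewrite (inj_eq (@aut_inj g)).
rewrite nbr_aut big_imfset /=; last by move=> ? ? _ _; exact: aut_inj.
by apply: eq_bigr => z _; rewrite srw_aut IH.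
Qed.

End graph.

(** * Return probabilities of the walk to a finite set *)

Section kernel_return.
Context {V : choiceType} (E : rel V) {R : realType}.
Hypothesis E_simple : simple_graph E.
Hypothesis E_locally_finite : locally_finite E.
Hypothesis E_transitive : vertex_transitive E.
Local Open Scope fset_scope.
Notation P := (srw_matrix R E).
Notation kernel := (@kernel V E R).

Section window.
Variable W : {fset V}.

(** The walk killed on leaving [W]: a symmetric substochastic matrix on a finite type, to which
    [return_decay] applies. *)
Definition win_matrix (x y : W) : R := P (val x) (val y).

Definition win_ext (f : W -> R) (v : V) : R := if insub v is Some w then f w else 0.

Lemma win_extE f w : win_ext f (val w) = f w.
Proof. by rewrite /win_ext valK. Qed.

Lemma win_sym x y : win_matrix x y = win_matrix y x.
Proof. exact: srw_sym. Qed.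

Lemma win_ge0 x y : 0 <= win_matrix x y.
Proof. exact: srw_ge0. Qed.

Lemma win_sub x : \sum_y win_matrix x y <= 1.
Proof.
by rewrite -(big_seq_fsetE _ _ predT (fun v => P (val x) v)) srw_sum_le1.
Qed.

Lemma win_faber_krahn (n lam : R) (m : nat) (A : {set W}) (f : W -> R) :
  (lam%:E <= spectral_profile P n)%E -> m%:R <= n -> (#|A| <= m)%N ->
  (forall x, x \notin A -> f x = 0) ->
  lam * sqn f <= sqn f - scal (op win_matrix f) f.
Proof.
move=> lamP mn Am fA.
pose A' : {fset V} := [fset val w | w in A].
have A'W : A' `<=` W by apply/fsubsetP => v /imfsetP[w _ ->]; exact: valP.
have cA' : #|` A'|%:R <= n.
  apply: le_trans mn; rewrite ler_nat; apply: leq_trans Am.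
  rewrite card_imfset ?cardE//; exact: val_inj.
have eA' v : v \notin A' -> win_ext f v = 0.
  move=> vA'; rewrite /win_ext; case: insubP => // w _ wv; apply: fA.
  by apply: contra vA' => wA; apply/imfsetP; exists w.
have := spectral_profile_faber_krahn lamP A'W cA' eA'.
rewrite !big_seq_fsetE /=.
have -> : \sum_(w : W) win_ext f (val w) ^+ 2 = sqn f.
  by apply: eq_bigr => w _; rewrite win_extE.
suff -> : \sum_(w : W) (\sum_(y <- W) P (val w) y * win_ext f y) * win_ext f (val w)
  = scal (op win_matrix f) f by [].
apply: eq_bigr => w _; rewrite big_seq_fsetE win_extE; congr (_ * _).
by apply: eq_bigr => v _; rewrite win_extE.
Qed.


Lemma sum_fsub Om (F : V -> R) : Om `<=` W ->
  \sum_(w in fsub W Om) F (val w) = \sum_(x <- Om) F x.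
Proof.
move=> OmW; under eq_bigl do rewrite in_fsub.
rewrite -(big_seq_fsetE _ _ (fun v => v \in Om) F) big_mkcond /=.
transitivity (\sum_(x <- Om) (if x \in Om then F x else 0)).
  by apply/esym/big_fset_incl => // x _ /negbTE ->.
by rewrite big_seq [RHS]big_seq; apply: eq_bigr => x ->.
Qed.

(** A walk of [j] steps stays in the ball of radius [j], so inside such a window it is never
    killed. *)
Lemma win_iter_kernel Om j (w : W) : Om `<=` W -> ball E j (val w) `<=` W ->
  iterop_fun win_matrix j (ind (fsub W Om)) w = \sum_(y <- Om) kernel j (val w) y.
Proof.
move=> OmW; elim: j w => [|j IH] w bW /=.
  rewrite /ind in_fsub; case: (boolP (val w \in Om)) => wOm.
    by rewrite (big_fsetD1 (val w)) //= eqxx big1_fset ?addr0// => y;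
      rewrite !inE eq_sym => /andP[/negbTE ->].
  by rewrite big1_fset// => y yOm _; case: eqVneq => // wy; move: wOm; rewrite /= wy yOm.
have nW z : E (val w) z -> ball E j z `<=` W.
  by move=> wz; apply: fsubset_trans bW; exact: ball_sub_nbr.
have nbW : nbr E (val w) `<=` W.
  apply/fsubsetP => z; rewrite in_nbr// => wz.
  by apply: (fsubsetP (nW _ wz)); exact: ball_self.
rewrite exchange_big /= /op.
under [RHS]eq_bigr => z _ do rewrite -mulr_sumr.
rewrite (srw_sum_nbr E_locally_finite _ nbW) big_seq_fsetE; apply: eq_bigr => z _.
rewrite /win_matrix; have [wz|wz] := boolP (E (val w) (val z)).
  by rewrite IH//; exact: nW.
by rewrite /srw_matrix (negbTE wz) !mul0r.
Qed.

End window.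

(** The form of the pair [(g, g)] is twice the Dirichlet form, and [double_dirichletE] writes it as
    a sum of non-negative terms. *)
Lemma spectral_profile_srw_ge0 (n : R) : (0 <= spectral_profile P n)%E.
Proof.
apply: le_ereal_inf_tmp => _ [Om _ <-]; apply: le_ereal_inf_tmp => _ [f [fOm _] <-].
have fO x : x \notin Om -> f x = 0 by move=> xO; apply/eqP; apply: contraNT xO => /fOm.
rewrite lee_fin (dirichlet_finsum _ fO) !big_seq_fsetE /=.
pose g (w : Om) := f (val w).
have := double_dirichletE (@win_sym Om) g g.
have -> : scal (op (@win_matrix Om) g) g =
    \sum_(w : Om) (\sum_(y <- Om) P (val w) y * f y) * f (val w).
  by apply: eq_bigr => w _; rewrite big_seq_fsetE.
rewrite -/(sqn g) => H.
suff : 0 <= sqn g + sqn g - 2 * (\sum_(w : Om) (\sum_(y <- Om) P (val w) y * f y) * f (val w)).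
  lra.
rewrite H addr_ge0// sumr_ge0// => w _.
  by apply: mulr_ge0; [rewrite subr_ge0 win_sub|rewrite addr_ge0 ?sqr_ge0].
by apply: sumr_ge0 => v _; rewrite mulr_ge0 ?sqr_ge0 ?win_ge0.
Qed.

(** The test function is the indicator of a point. With the lower bound, this makes the profile a
    real number in [[0, 1]]. *)
Lemma spectral_profile_srw_le1 (o : V) (n : R) : 1 <= n -> (spectral_profile P n <= 1)%E.
Proof.
move=> n1; apply: le_trans (ereal_inf_lbound _) _.
  by exists [fset o]; rewrite //= cardfs1; split => //; apply/fset0Pn; exists o; rewrite inE.
pose f x : R := (x == o)%:R.
have fo x : x \notin [fset o] -> f x = 0 by rewrite inE /f => /negbTE ->.
apply: le_trans (ereal_inf_lbound _) _.
  exists f => //; split; first by move=> x; apply: contra_neqT => /fo.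
  by rewrite (norm2_finsum fo) big_seq_fset1 /f eqxx expr1n sqrtr1.
rewrite lee_fin (dirichlet_finsum _ fo) !big_seq_fset1 /f eqxx !mulr1 expr1n.
by rewrite lerBlDr lerDl srw_ge0.
Qed.

(** This is [return_decay] in a finite window with [x = 2^-l] and [rho = expR (- lam)], where [lam]
    is the value of the profile. The rate condition gives [rho ^+ k <= 2^-l], and [decay_to_sqrt]
    bounds the resulting sum. *)
Lemma kernel_return_bound (Om : {fset V}) (t : R) (k l : nat) :
  (3 <= l)%N -> Om != fset0 -> #|` Om|%:R <= t ->
  ((l%:R * ln 2)%:E / spectral_profile P (2 ^+ l.+1 * t) <= k%:R%:E)%E ->
  \sum_(x <- Om) \sum_(y <- Om) kernel k x y <=
    #|` Om|%:R * expR (- (ln 2 / 2 * l%:R)).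
Proof.
move=> l3 Om0 Omt; have [v0 v0Om] := fset0Pn _ Om0.
have Om1 : 1 <= #|` Om|%:R :> R by rewrite ler1n cardfs_gt0.
have p1 : 1 <= 2 ^+ l.+1 :> R by rewrite exprn_ege1// ler1n.
have n1 : 1 <= 2 ^+ l.+1 * t by nra.
have := spectral_profile_srw_ge0 (2 ^+ l.+1 * t).
have := spectral_profile_srw_le1 v0 n1.
case Elam : (spectral_profile _ _) => [lam| |] //; rewrite !lee_fin => lam1 lam0.
(* A vanishing profile makes the ratio [+oo], since [l > 0], against the assumption. *)
have [->|lamN0] := eqVneq lam 0.
  by rewrite inver eqxx gt0_muley // lte_fin mulr_gt0 ?ltr0n ?ln_gt0 ?ltr1n// (leq_trans _ l3).
have lam_gt0 : 0 < lam by rewrite lt_neqAle eq_sym lamN0.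
rewrite inver (negbTE lamN0) -EFinM lee_fin ler_pdivrMr// => rate.
(* Contains every path of [k] steps that starts in [Om]. *)
pose W := \bigcup_(x <- Om) ball E k x.
have bW x : x \in Om -> ball E k x `<=` W.
  by move=> xOm; apply/fsubsetP => y xy; apply/bigfcupP; exists x; rewrite ?xOm.
have OmW : Om `<=` W.
  by apply/fsubsetP => x xOm; apply: (fsubsetP (bW _ xOm)); exact: ball_self.
(* The smallest support size that [return_decay] allows for [x = 2^-l]. *)
pose m := (2 ^ l.+1 * #|` Om|)%N.
have mn : m%:R <= 2 ^+ l.+1 * t by rewrite natrM natrX ler_pM2l// exprn_gt0.
have x0 : 0 < 2^-1 ^+ l :> R by rewrite exprn_gt0.
have x8 : 2^-1 ^+ l <= 2^-1 ^+ 3 :> R by apply: ler_wiXn2l => //; lra.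
have x2 : 2 * 2^-1 ^+ l <= 1 :> R by move: x8; rewrite !exprS expr0; lra.
have small : 2 * #|fsub W Om|%:R <= m%:R * 2^-1 ^+ l :> R.
  rewrite card_fsub// natrM natrX exprS -mulrA [_ * 2^-1 ^+ l]mulrC.
  by rewrite mulrA -[2 * _ * _]mulrA -exprMn divff// expr1n mulr1.
have lamS : (lam%:E <= spectral_profile P (2 ^+ l.+1 * t))%E by rewrite Elam.
have lam01 : 0 <= lam <= 1 by rewrite lam0.
have rho1 : 1 - lam <= expR (- lam) by exact: expR_ge1Dx.
have := return_decay (@win_sym W) (@win_ge0 W) (@win_sub W)
  (fun A f => @win_faber_krahn W _ lam m A f lamS mn)
  k x0 x2 lam01 small (expR_ge0 _) rho1 (le_expRN2 lam0).
rewrite card_fsub//.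
have -> : scal (iterop_fun (@win_matrix W) k (ind (fsub W Om))) (ind (fsub W Om))
    = \sum_(x <- Om) \sum_(y <- Om) kernel k x y.
  rewrite -(sum_fsub _ OmW) [RHS]big_mkcond; apply: eq_bigr => w _.
  rewrite {2}/ind; case: (boolP (w \in _)) => [wOm|_]; last by rewrite mulr0.
  by rewrite mulr1 win_iter_kernel//; apply: bW; rewrite -in_fsub.
move=> /le_trans; apply; apply: ler_wpM2l => //.
apply: le_trans (decay_to_sqrt l3); rewrite lerD2l ler_wpM2l ?subr_ge0//.
exact: expR_rate.
Qed.

End kernel_return.

(** * Attainment in the isoperimetric profile and its inverse *)

Section isoperimetry.
Context {V : choiceType} (E : rel V) {R : realType}.
Hypothesis E_locally_finite : locally_finite E.
Local Open Scope fset_scope.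
Notation P := (srw_matrix R E).

Definition boundary_size (Om : {fset V}) : nat :=
  \sum_(x <- Om) #|` nbr E x `\` Om|.

Lemma esum_srw_boundary (Om : {fset V}) x :
  \esum_(y in ~` [set` Om]) (P x y)%:E =
  (#|` nbr E x `\` Om|%:R * (degree E x)%:R^-1)%:E.
Proof.
have P0 y : 0 <= P x y by rewrite /srw_matrix; case: ifP.
rewrite (esumID [set` nbr E x]); last by move=> y _; rewrite lee_fin.
rewrite [X in (_ + X)%E]esum1 ?adde0; last first.
  by move=> y [_ /=]; rewrite in_nbr// /srw_matrix => /negP/negbTE ->.
have -> : (~` [set` Om] `&` [set` nbr E x] = [set` (nbr E x `\` Om)%fset])%classic.
  by apply/seteqP; split => y /=; rewrite inE; [move=> [/negP -> ->]|move=> /andP[/negP]].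
rewrite esum_fset; [|exact: finite_fset|by move=> y _; rewrite lee_fin].
rewrite fsbig_finite; last exact: finite_fset.
rewrite set_fsetK sumEFin; congr EFin.
rewrite big_seq (eq_bigr (fun=> (degree E x)%:R^-1)); last first.
  by move=> y; rewrite inE in_nbr// /srw_matrix => /andP[_ ->].
by rewrite -big_seq big_const_seq count_predT iter_addr_0 -[LHS]mulr_natl.
Qed.

Hypothesis E_transitive : vertex_transitive E.

Lemma boundary_ratio (o : V) (Om : {fset V}) :
  ((#|` Om|%:R)^-1%:E * \sum_(x <- Om) \esum_(y in ~` [set` Om]) (P x y)%:E)%E
  = ((boundary_size Om)%:R / #|` Om|%:R * (degree E o)%:R^-1)%:E.
Proof.
under eq_bigr do rewrite esum_srw_boundary (degree_const E_locally_finite E_transitive _ o).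
by rewrite sumEFin -EFinM -mulr_suml -natr_sum; congr EFin; rewrite mulrA [_^-1 * _]mulrC.
Qed.

(* The ratios of sets of bounded size have bounded denominators, so that the
   infimum in the isoperimetric profile is attained. *)
Lemma isoperimetric_attained (o : V) (t s : R) : (1 <= t) ->
  (isoperimetric_profile P t <= s%:E)%E ->
  exists Om : {fset V}, [/\ Om != fset0, #|` Om|%:R <= t &
    (boundary_size Om)%:R / #|` Om|%:R * (degree E o)%:R^-1 <= s].
Proof.
move=> t1 tP; have t0 : 0 <= t by apply: le_trans t1.
pose ok (Om : {fset V}) := Om != fset0 /\ #|` Om|%:R <= t.
pose N := Num.truncn t.
(* Every size up to [N] divides the factorial of [N]. Over this common denominator the ratios have
   natural numerators [K Om], among which there is a least one. *)
pose K (Om : {fset V}) := (boundary_size Om * (N`! %/ #|` Om|))%N.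
have KE Om : ok Om -> (boundary_size Om)%:R / #|` Om|%:R = (K Om)%:R / N`!%:R :> R.
  move=> [Om0 Omt]; have c0 : (0 < #|` Om|)%N by rewrite cardfs_gt0.
  have cN : (#|` Om| <= N)%N by rewrite truncn_ge_nat.
  have dv : (#|` Om| %| N`!)%N by apply: dvdn_fact; rewrite c0.
  rewrite /K natrM -mulrA; congr (_ * _).
  have {2}-> : N`! = (N`! %/ #|` Om| * #|` Om|)%N by rewrite divnK.
  rewrite natrM invfM mulrA divff ?mul1r// pnatr_eq0 -lt0n divn_gt0//.
  by rewrite dvdn_leq// fact_gt0.
pose A := [set K Om | Om in ok].
have A0 : A !=set0.
  apply/set0P/eqP => A0; move: tP; apply/negP.
  have -> : isoperimetric_profile P t = +oo%E.
    rewrite /isoperimetric_profile -ereal_inf0; congr ereal_inf.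
    apply/seteqP; split => // z [Om okOm _].
    by have : A (K Om) by [exists Om]; rewrite A0.
  by rewrite -ltNge ltry.
have [[Om okOm KOm] Kmin] := set_minP A0.
exists Om; have [Om0 Omt] := okOm; split => //.
rewrite -lee_fin; apply: le_trans tP; apply: le_ereal_inf_tmp => _ [Om' okOm' <-].
rewrite (boundary_ratio o) lee_fin ler_wpM2r ?invr_ge0// (KE _ okOm) (KE _ okOm').
by rewrite ler_wpM2r ?invr_ge0// ler_nat KOm; apply: Kmin; exists Om'.
Qed.

(** Sizes are integers: some [u] below the integer part of [t] plus one has profile at most [s], and
    a set of size at most [u] then has size at most [t]. *)
Lemma decr_inv_isoperimetric (o : V) (s t : R) :
  decr_inv (isoperimetric_profile P) s = t%:E ->
  exists Om : {fset V}, [/\ Om != fset0, #|` Om|%:R <= t &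
    (boundary_size Om)%:R <= s * (degree E o)%:R * #|` Om|%:R].
Proof.
move=> Et.
have t1 : 1 <= t.
  rewrite -lee_fin -Et; apply: le_ereal_inf_tmp => _ [u [u1 _] <-].
  by rewrite lee_fin.
have t0 : 0 <= t by apply: le_trans t1.
have : (decr_inv (isoperimetric_profile P) s < (Num.truncn t).+1%:R%:E)%E.
  by rewrite Et lte_fin truncnS_gt.
move=> /ereal_inf_lt[_ [u [u1 uP] <-]]; rewrite lte_fin => ut.
have [Om [Om0 Omu HOm]] := isoperimetric_attained o u1 uP.
exists Om; split => //.
  apply: le_trans (_ : (Num.truncn t)%:R <= _); last by rewrite truncn_le.
  by rewrite ler_nat -ltnS -(ltr_nat R); exact: le_lt_trans ut.
have c0 : 0 < #|` Om|%:R :> R by rewrite ltr0n cardfs_gt0.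
(* Here the inverse degree is [0] by convention and the ratio carries no information, but without
   edges the boundary is empty. *)
have [d0|d0] := eqVneq (degree E o) 0%N.
  rewrite d0 mulr0 mul0r lern0 /boundary_size big1// => x _.
  apply/eqP; rewrite cardfs_eq0 -fsubset0 -[fset0](_ : nbr E x = _) ?fsubsetDl//.
  by apply: cardfs0_eq; rewrite -degree_nbr (degree_const E_locally_finite E_transitive x o).
have {}d0 : 0 < (degree E o)%:R :> R by rewrite ltr0n lt0n.
by move: HOm; rewrite ler_pdivrMr// ler_pdivrMr.
Qed.

End isoperimetry.

(** * Automorphism groups and Haar measure *)

Section aut_topology.
Context {V : choiceType} (E : rel V).
Implicit Types (a b x y : V) (g : Aut E).

(** When non-empty, a coset of the stabiliser of [a]. These sets form a subbasis of the topology; in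
    a connected locally finite graph they are also compact. *)
Definition maps a b : set (Aut E) := [set g | aut_fun g a = b].

Lemma open_maps a b : open (maps a b).
Proof.
have cont : continuous (fun f : {ptws V -> discrete_topology V} => f a).
  exact: (@proj_continuous V (fun=> discrete_topology V) a).
exists ((fun f : {ptws V -> discrete_topology V} => f a) @^-1` [set b]) => //.
apply: open_comp; first by move=> f _; exact: cont.
exact: (@discrete_open (discrete_topology V)).
Qed.

Lemma measurable_maps a b : measurable (maps a b : set (aut_borel E)).
Proof. by apply: sub_sigma_algebra; exact: open_maps. Qed.

Lemma aut_cvg (F : set_system (Aut E)) g : Filter F ->
  (forall x, F (maps x (aut_fun g x))) -> F --> g.
Proof.
move=> FF Fmaps A [_ [[B Bop <-] Bg sBA]].
suff /(_ B) : {ptws, set_val @ F --> (aut_fun g : V -> discrete_topology V)}.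
  rewrite nbhs_filterE; move=> H; apply: filterS sBA _; apply: H.
  by apply: open_nbhs_nbhs; split.
apply/(@pointwise_cvgP (discrete_topology V) (discrete_topology V)) => x.
by apply/discrete_cvg; exact: Fmaps.
Qed.

Hypothesis E_locally_finite : locally_finite E.
Hypothesis E_connected : graph_connected E.

(** An automorphism carrying [a] to [b] sends [x] into a fixed finite ball around [b], and an
    ultrafilter selects one of finitely many images. *)
Lemma ultra_maps (F : set_system (Aut E)) a b x : UltraFilter F ->
  F (maps a b) -> exists y, F (maps x y).
Proof.
move=> FU Fab; have [p [pp lp]] := E_connected a x; pose n := size p.
apply: contrapT => /forallNP none.
have Fall : F (\bigcap_(y in [set` ball E n b]) ~` maps x y).
  apply: filter_bigI => y _; have [/none //|//] := in_ultra_setVsetC (maps x y) FU.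
have [g [gab gall]] := filter_ex (filterI (F := F) Fab Fall).
apply: (gall (aut_fun g x)) => //=.
rewrite -gab ball_aut//; apply/imfsetP; exists x => //=.
by apply/in_ball => //; exists p.
Qed.

(* Tychonoff by hand: along an ultrafilter every [g x] is eventually constant,
   and the pointwise limit is onto because the balls around [b] are finite. *)
Lemma compact_maps a b : compact (maps a b).
Proof.
rewrite compact_ultra => F FU Fab.
have /choice[lim Flim] : forall x, exists y, F (maps x y).
  by move=> x; apply: ultra_maps Fab.
have ex2 x y : exists g, aut_fun g x = lim x /\ aut_fun g y = lim y.
  by have [g [gx gy]] := filter_ex (filterI (F := F) (Flim x) (Flim y)); exists g.
have limE x y : E (lim x) (lim y) = E x y.
  by have [g [<- <-]] := ex2 x y; rewrite aut_edge.
have lim_inj : injective lim.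
  by move=> x y; have [g [<- <-]] := ex2 x y; exact: aut_inj.
have limab : lim a = b.
  by have [g [ga gb]] := filter_ex (filterI (F := F) Fab (Flim a)); rewrite -ga.
have lim_surj y : exists x, lim x = y.
  have [p [pp lp]] := E_connected b y; pose n := size p.
  have yb : y \in ball E n b by apply/in_ball => //; exists p.
  have Fall : F (\bigcap_(x in [set` ball E n a]) maps x (lim x)).
    by apply: filter_bigI => x _; exact: Flim.
  have [g [gab gall]] := filter_ex (filterI (F := F) Fab Fall).
  move: yb; rewrite -gab ball_aut// => /imfsetP[x /= xn ->].
  by exists x; rewrite -(gall x).
have lim_bij : bijective lim.
  have /choice[inv invK] := lim_surj.
  by exists inv => // x; apply: lim_inj; rewrite invK.
have lim_aut : lim \in aut_set E by apply/mem_set.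
exists (SigSub lim_aut); split; first exact: limab.
by apply: aut_cvg => x; exact: Flim.
Qed.

End aut_topology.

(** * Real-valued masses of sets of finite measure *)

Section finite_measure_sums.
Context {R : realType} {d : measure_display} {T : measurableType d}.
Variable mu : {measure set T -> \bar R}.

(** Real values permit linear arithmetic; infinite measure is sent to [0], hence the finiteness
    conditions below. *)
Definition rmu (A : set T) : R := fine (mu A).

Lemma rmuE A : (mu A < +oo)%E -> mu A = (rmu A)%:E.
Proof. by move=> Afin; rewrite fineK// ge0_fin_numE. Qed.

Lemma mu_finS (A B : set T) : measurable A -> measurable B -> A `<=` B ->
  (mu B < +oo)%E -> (mu A < +oo)%E.
Proof. by move=> mA mB AB; apply: le_lt_trans; rewrite le_measure ?inE. Qed.

Lemma rmu_ge0 A : 0 <= rmu A.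
Proof. exact: fine_ge0. Qed.

(** Finiteness is part of the conclusion, so that finite unions of cosets inherit it, as in
    [hits_finite]. *)
Lemma rmu_subadditive (I : choiceType) (s : seq I) (A : set T) (F : I -> set T) :
  measurable A -> (forall i, measurable (F i)) -> (forall i, (mu (F i) < +oo)%E) ->
  A `<=` \bigcup_(i in [set` s]) F i ->
  (mu A < +oo)%E /\ rmu A <= \sum_(i <- s) rmu (F i).
Proof.
move=> mA mF finF; rewrite bigcup_seq => AF.
have mU : measurable (\big[setU/set0]_(i <- s) F i) by exact: bigsetU_measurable.
have le1 : (mu A <= mu (\big[setU/set0]_(i <- s) F i))%E by rewrite le_measure ?inE.
have le2 : (mu (\big[setU/set0]_(i <- s) F i) <= (\sum_(i <- s) rmu (F i))%:E)%E.
  elim: s {mA AF le1 mU} => [|i s IH]; first by rewrite !big_nil measure0.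
  rewrite !big_cons EFinD -rmuE//; apply: le_trans (measureU2 _ _ _) _ => //.
    exact: bigsetU_measurable.
  by rewrite leeD2l.
have le3 := le_trans le1 le2.
have Afin : (mu A < +oo)%E by apply: le_lt_trans le3 _; rewrite ltry.
by split => //; rewrite -lee_fin -rmuE.
Qed.

Lemma le_rmu (A B : set T) : measurable A -> measurable B -> (mu B < +oo)%E ->
  A `<=` B -> rmu A <= rmu B.
Proof.
move=> mA mB Bfin AB; have AleB : (mu A <= mu B)%E by rewrite le_measure ?inE.
by rewrite -lee_fin -!rmuE//; exact: mu_finS Bfin.
Qed.

Lemma rmu_superadditive (I : choiceType) (s : {fset I}) (A : set T) (F : I -> set T) :
  measurable A -> (forall i, measurable (F i)) -> (mu A < +oo)%E ->
  trivIset [set` s] F -> (forall i, i \in s -> F i `<=` A) ->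
  \sum_(i <- s) rmu (F i) <= rmu A.
Proof.
move=> mA mF Afin trivF FA.
have : (mu (\big[setU/set0]_(i <- s) F i) <= mu A)%E.
  rewrite le_measure ?inE//; first exact: bigsetU_measurable.
  by rewrite -bigcup_seq; apply: bigcup_sub.
rewrite measure_fbigsetU// (rmuE Afin) big_seq (eq_bigr (fun i => (rmu (F i))%:E)).
  by rewrite sumEFin lee_fin -big_seq.
by move=> i si; apply: rmuE; exact: mu_finS (mF i) mA (FA i si) Afin.
Qed.

End finite_measure_sums.

(** * Mass transport with respect to Haar measure *)

Section haar.
Context {R : realType} {V : choiceType} (E : rel V).
Variable mu : {measure set (aut_borel E) -> \bar R}.
Hypothesis E_simple : simple_graph E.
Hypothesis E_locally_finite : locally_finite E.
Hypothesis E_connected : graph_connected E.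
Hypothesis E_transitive : vertex_transitive E.
Hypothesis mu_left : left_haar mu.
Hypothesis mu_right : right_invariant mu.

Definition maps2 (a x b y : V) : set (aut_borel E) := maps a x `&` maps b y.

Lemma measurable_maps2 a x b y : measurable (maps2 a x b y).
Proof. by apply: measurableI; exact: measurable_maps. Qed.

Lemma maps2_translate (h : Aut E) a x b y :
  rmu mu (maps2 a (aut_fun h x) b (aut_fun h y)) = rmu mu (maps2 a x b y).
Proof.
have [_ _ /(_ h _ (measurable_maps2 a (aut_fun h x) b (aut_fun h y)))] := mu_left.
rewrite /rmu => <-; congr (fine (mu _)); apply/seteqP; split => g /=.
  by rewrite /maps2 /maps /= !aut_mulE => -[/aut_inj -> /aut_inj ->].
by rewrite /maps2 /maps /= !aut_mulE => -[-> ->].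
Qed.

Lemma maps_finite a x : (mu (maps a x) < +oo)%E.
Proof. by have [_ + _] := mu_left; apply; exact: compact_maps. Qed.

(** Left translation moves the target and right translation the source. This is the point where
    unimodularity enters. *)
Lemma maps_const a x b y : mu (maps a x) = mu (maps b y).
Proof.
have [h hx] := E_transitive x y; have [k kb] := E_transitive a b.
have [_ _ /(_ h _ (@measurable_maps _ E a y))] := mu_left.
rewrite (_ : _ @^-1` _ = maps a x) => [->|]; last first.
  apply/seteqP; split => g; rewrite /maps /= aut_mulE -hx; [exact: aut_inj|by move=> ->].
have := mu_right k (@measurable_maps _ E a y).
rewrite (_ : _ @^-1` _ = maps b y) => [->//|].
by apply/seteqP; split => g; rewrite /maps /= aut_mulE kb.
Qed.

(** Otherwise every coset is null by [maps_const]; countably many of them cover the group, against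
    [mu setT != 0]. *)
Lemma maps_gt0 a x : 0 < rmu mu (maps a x).
Proof.
rewrite -lte_fin -rmuE; last exact: maps_finite.
rewrite measure_gt0; apply/eqP => mu0; have [/eqP + _ _] := mu_left; apply.
have /countable_injP[f finj] := graph_countable E_locally_finite E_connected a.
have -> : [set: aut_borel E] = \bigcup_n [set g | f (aut_fun g a) = n].
  by apply/seteqP; split => // g _; exists (f (aut_fun g a)).
apply: measure_negligible; last first.
  apply: negligible_bigcup => n.
  have [[g fg]|none] := pselect (exists g : Aut E, f (aut_fun g a) = n); last first.
    by apply: negligibleS (negligible_set0 mu) => g fg; apply: none; exists g.
  exists (maps a (aut_fun g a)); split; first exact: measurable_maps.
    by rewrite (maps_const _ _ a x).
  by move=> h fh; apply: finj; rewrite ?inE// fg.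
apply: bigcupT_measurable => n.
have [[g fg]|none] := pselect (exists g : Aut E, f (aut_fun g a) = n); last first.
  by rewrite (_ : [set _ | _] = set0)//; apply/seteqP; split => // g fg; apply: none; exists g.
rewrite (_ : [set _ | _] = maps a (aut_fun g a)); first exact: measurable_maps.
apply/seteqP; split => h; rewrite /maps /=; last by move=> ->.
by move=> fh; apply: finj; rewrite ?inE// fg.
Qed.

Variable o : V.
Let M := rmu mu (maps o o).
Let m := min_orbit_size E o.
Notation kernel := (@kernel V E R).

Lemma maps_mass a x : rmu mu (maps a x) = M.
Proof. by rewrite /M /rmu (maps_const a x o o). Qed.

Lemma maps2_finite a x b y : (mu (maps2 a x b y) < +oo)%E.
Proof.
exact: mu_finS (measurable_maps2 a x b y) (@measurable_maps _ E a x)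
  (@subIsetl _ _ _) (maps_finite a x).
Qed.

Lemma finite_edge_orbit e :
  finite_set (edge_orbit E e `&` oriented_edges_from E o).
Proof.
apply: sub_finite_set (_ : _ `<=` [set` [fset (o, z) | z in nbr E o]%fset]) _.
  move=> [x y] [_ [/= xy /= xo]]; apply/imfsetP; exists y; rewrite -?xo//=.
  by rewrite in_nbr.
exact: finite_fset.
Qed.

(* The automorphisms carrying the edge [(a, b)] to an edge at [o] split into at
   least [m] cosets of equal mass. *)
Lemma edge_mass a b x y : E a b -> m%:R * rmu mu (maps2 a x b y) <= M.
Proof.
move=> ab; have [[h [hx hy]]|none] := pselect (maps2 a x b y !=set0); last first.
  have -> : rmu mu (maps2 a x b y) = 0.
    rewrite /rmu (_ : maps2 _ _ _ _ = set0) ?measure0//.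
    by apply/seteqP; split => // h hh; apply: none; exists h.
  by rewrite mulr0 rmu_ge0.
pose S := fset_set (edge_orbit E (a, b) `&` oriented_edges_from E o).
have Sin e : e \in S = (e \in edge_orbit E (a, b) `&` oriented_edges_from E o).
  by rewrite in_fset_set//; exact: finite_edge_orbit.
have mS : (m <= #|` S|)%N.
  have [_ Smin] := @set_minP [set #|` fset_set (edge_orbit E e `&` oriented_edges_from E o)|
          | e in oriented_edges E] (ex_intro _ _ (ex_intro2 _ _ (a, b) ab erefl)).
  by apply: Smin; exists (a, b).
(* Both sets are left translates of the pointwise stabiliser [maps2 a a b b]. *)
have mass e : e \in S -> rmu mu (maps2 a e.1 b e.2) = rmu mu (maps2 a x b y).
  rewrite Sin inE => -[[g _ <-] _] /=.
  by rewrite -hx -hy !(maps2_translate _ a a b b).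
have : \sum_(e <- S) rmu mu (maps2 a e.1 b e.2) <= rmu mu (maps a o).
  apply: rmu_superadditive.
  - exact: measurable_maps.
  - by move=> e; exact: measurable_maps2.
  - exact: maps_finite.
  - move=> [e1 e2] [f1 f2] _ _ [g [[/= g1 g2] [/= g3 g4]]].
    by rewrite -g1 -g2 -g3 -g4.
  - by move=> e; rewrite Sin inE => -[_ [_ <-]]; exact: subIsetl.
rewrite maps_mass; apply: le_trans.
rewrite big_seq (eq_bigr (fun=> rmu mu (maps2 a x b y))); last by move=> e /mass.
rewrite -big_seq big_const_seq count_predT iter_addr_0 -[leRHS]mulr_natl.
by rewrite ler_wpM2r ?rmu_ge0// ler_nat.
Qed.


(** By transitivity every edge orbit contains an edge leaving [o]. Positive degree provides an edge,
    so that the minimum is a genuine one. *)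
Lemma min_orbit_size_gt0 : (0 < degree E o)%N -> (0 < m)%N.
Proof.
rewrite degree_nbr cardfs_gt0 => /fset0Pn[b]; rewrite in_nbr// => ob.
rewrite /m /min_orbit_size.
have [[[a c] ac <-] _] := @set_minP [set #|` fset_set (edge_orbit E e `&` oriented_edges_from E o)|
          | e in oriented_edges E] (ex_intro _ _ (ex_intro2 _ _ (o, b) ob erefl)).
have [h ha] := E_transitive a o.
rewrite cardfs_gt0; apply/fset0Pn; exists (aut_fun h a, aut_fun h c).
rewrite in_fset_set; last exact: finite_edge_orbit.
by rewrite inE; split; [exists h|split; rewrite /oriented_edges /= ?aut_edge].
Qed.

Implicit Types (Om : {fset V}).

Definition hits Om a : set (aut_borel E) := [set g | aut_fun g a \in Om].

Lemma hitsE Om a : hits Om a = \bigcup_(x in [set` Om]) maps a x.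
Proof.
apply/seteqP; split => g; first by move=> gO; exists (aut_fun g a).
by move=> [x xO gx]; rewrite /hits /= gx.
Qed.

Lemma measurable_hits Om a : measurable (hits Om a).
Proof.
rewrite hitsE; apply: fin_bigcup_measurable => [|x _]; first exact: finite_fset.
exact: measurable_maps.
Qed.

Lemma hits_finite Om a : (mu (hits Om a) < +oo)%E.
Proof.
have [] // := @rmu_subadditive _ _ _ mu _ Om (hits Om a) (fun x => maps a x)
  (measurable_hits Om a) (measurable_maps a) (maps_finite a).
by rewrite hitsE.
Qed.

Lemma hits_mass Om a : #|` Om|%:R * M <= rmu mu (hits Om a).
Proof.
have -> : #|` Om|%:R * M = \sum_(x <- Om) rmu mu (maps a x).
  under eq_bigr do rewrite maps_mass.
  by rewrite big_const_seq count_predT iter_addr_0 -[RHS]mulr_natl.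
apply: rmu_superadditive.
- exact: measurable_hits.
- exact: measurable_maps.
- exact: hits_finite.
- by move=> x y _ _ [g [<- <-]].
- by move=> x xO g gx; rewrite /hits /= gx.
Qed.

(** Such automorphisms carry [(a, b)] onto a boundary edge of [Om], and by [edge_mass] each boundary
    edge accounts for mass at most [M / m]. *)
Lemma escape_mass Om a b : E a b ->
  m%:R * rmu mu (hits Om a `\` hits Om b) <= (boundary_size E Om)%:R * M.
Proof.
move=> ab; pose F x := \bigcup_(y in [set` (nbr E x `\` Om)%fset]) maps2 a x b y.
have mF x : measurable (F x).
  apply: fin_bigcup_measurable => [|y _]; first exact: finite_fset.
  exact: measurable_maps2.
have F_sub x := @rmu_subadditive _ _ _ mu _ (nbr E x `\` Om)%fset (F x)
  (fun y => maps2 a x b y) (mF x) (measurable_maps2 a x b) (maps2_finite a x b)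
  (@subset_refl _ _).
have incl : hits Om a `\` hits Om b `<=` \bigcup_(x in [set` Om]) F x.
  move=> g [ga gb]; exists (aut_fun g a) => //; exists (aut_fun g b) => //=.
  by rewrite inE in_nbr// aut_edge ab andbT; apply/negP.
have [_ H] := rmu_subadditive
  (measurableD (measurable_hits Om a) (measurable_hits Om b)) mF
  (fun x => proj1 (F_sub x)) incl.
 apply: le_trans (ler_wpM2l (ler0n _ _) H) _.
rewrite mulr_sumr /boundary_size natr_sum mulr_suml; apply: ler_sum => x _.
apply: le_trans (ler_wpM2l (ler0n _ _) (proj2 (F_sub x))) _.
rewrite mulr_sumr; apply: le_trans (ler_sum _ (fun y _ => edge_mass x y ab)) _.
by rewrite big_const_seq count_predT iter_addr_0 -[leLHS]mulr_natl.
Qed.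

(** Induction along the path: each edge loses at most the mass bounded in [escape_mass]. *)
Lemma path_mass Om a z (p : seq V) : path E z p ->
  m%:R * rmu mu (hits Om a `&` hits Om z) <=
  m%:R * rmu mu (hits Om a `&` hits Om (last z p)) +
  (size p)%:R * ((boundary_size E Om)%:R * M).
Proof.
have mI x : measurable (hits Om a `&` hits Om x).
  by apply: measurableI; exact: measurable_hits.
have mD x y : measurable (hits Om x `\` hits Om y).
  by apply: measurableD; exact: measurable_hits.
have fI x : (mu (hits Om a `&` hits Om x) < +oo)%E.
  exact: mu_finS (mI x) (measurable_hits Om a) (@subIsetl _ _ _) (hits_finite Om a).
have fD x y : (mu (hits Om x `\` hits Om y) < +oo)%E.
  exact: mu_finS (mD x y) (measurable_hits Om x) (@subDsetl _ _ _) (hits_finite Om x).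
elim: p z => [|y p IH] z /=; first by rewrite mul0r addr0.
move=> /andP[zy /IH]; set B := hits Om a `&` hits Om (last y p).
pose F (c : bool) := if c then hits Om a `&` hits Om y else hits Om z `\` hits Om y.
have incl : hits Om a `&` hits Om z `<=` \bigcup_(c in [set` [:: true; false]]) F c.
  move=> g [ga gz]; have [gy|gy] := pselect (hits Om y g); first by exists true.
  by exists false.
have mF c : measurable (F c) by case: c; [exact: mI|exact: mD].
have fF c : (mu (F c) < +oo)%E by case: c; [exact: fI|exact: fD].
have [_] := rmu_subadditive (mI z) mF fF incl.
rewrite big_cons big_seq1 /F => H1 H2.
have := escape_mass Om zy; have m0 : 0 <= m%:R :> R by [].
have := ler_wpM2l m0 H1; rewrite -natr1; lra.
Qed.

(** The sets are disjoint in [z], because an automorphism sends only one vertex to [y]. *)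
Lemma maps2_sum_le a x y (B : {fset V}) :
  \sum_(z <- B) rmu mu (maps2 a x z y) <= M.
Proof.
rewrite -(maps_mass a x); apply: rmu_superadditive.
- exact: measurable_maps.
- by move=> z; exact: measurable_maps2.
- exact: maps_finite.
- by move=> z z' _ _ [g [[_ /= gz] [_ gz']]]; apply: (aut_inj (g := g)); rewrite gz.
- by move=> z _; exact: subIsetl.
Qed.

(** If an automorphism carries [(o, z)] to [(x, y)], the kernels agree by invariance; otherwise the
    mass is zero. *)
Lemma kernel_maps2 n x z y :
  kernel n o z * rmu mu (maps2 o x z y) = kernel n x y * rmu mu (maps2 o x z y) :> R.
Proof.
have [[h [<- <-]]|none] := pselect (maps2 o x z y !=set0); first by rewrite kernel_aut.
rewrite /rmu (_ : maps2 _ _ _ _ = set0) ?measure0 ?mulr0//.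
by apply/seteqP; split => // h hh; apply: none; exists h.
Qed.

(** Mass transport: the inequality [half] is weighted by [kernel n o z], the kernel is moved to
    [(x, y)] by [kernel_maps2], and summing the masses over [z] first costs at most [M] for each
    [(x, y)]. *)
Lemma ball_return Om (n r : nat) : (0 < m)%N ->
  2 * r%:R * (boundary_size E Om)%:R <= m%:R * #|` Om|%:R :> R ->
  #|` Om|%:R * \sum_(z <- ball E r o) kernel n o z <=
  2 * \sum_(x <- Om) \sum_(y <- Om) kernel n x y :> R.
Proof.
move=> m0 small; have M0 : 0 < M by exact: maps_gt0.
have mR : 0 < m%:R :> R by rewrite ltr0n.
(* The image of [o] lies in [Om] with mass at least [#|Om| * M]; by [small], a path of length at
   most [r] loses no more than half of that amount. *)
have half z : z \in ball E r o ->
    #|` Om|%:R * M <= 2 * \sum_(x <- Om) \sum_(y <- Om) rmu mu (maps2 o x z y).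
  move=> /(in_ball E_locally_finite)[p [pp <- sp]].
  have := path_mass Om o pp; rewrite setIid.
  pose F x := \bigcup_(y in [set` Om]) maps2 o x (last o p) y.
  have mF x : measurable (F x).
    apply: fin_bigcup_measurable => [|y _]; first exact: finite_fset.
    exact: measurable_maps2.
  have F_sub x := @rmu_subadditive _ _ _ mu _ Om (F x)
    (fun y => maps2 o x (last o p) y) (mF x) (measurable_maps2 o x (last o p))
    (maps2_finite o x (last o p)) (@subset_refl _ _).
  have incl : hits Om o `&` hits Om (last o p) `<=` \bigcup_(x in [set` Om]) F x.
    by move=> g [ga gb]; exists (aut_fun g o) => //; exists (aut_fun g (last o p)).
  have [_ H0] := rmu_subadditive
    (measurableI _ _ (measurable_hits Om o) (measurable_hits Om (last o p))) mF
    (fun x => proj1 (F_sub x)) incl.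
  have H1 := le_trans H0 (ler_sum _ (fun x _ => proj2 (F_sub x))) => H2.
  have H3 := hits_mass Om o.
  have sp' : (size p)%:R <= r%:R :> R by rewrite ler_nat.
  have b0 : 0 <= (boundary_size E Om)%:R * M by rewrite mulr_ge0// ltW.
  have H4 := ler_wpM2r b0 sp'.
  have H5 := ler_wpM2r (ltW M0) small.
  have H6 := ler_wpM2l (ltW mR) H1; have H7 := ler_wpM2l (ltW mR) H3.
  rewrite -(ler_pM2l mR); lra.
rewrite -(ler_pM2r M0).
apply: le_trans (_ : \sum_(z <- ball E r o) kernel n o z *
    (2 * \sum_(x <- Om) \sum_(y <- Om) rmu mu (maps2 o x z y)) <= _).
  rewrite mulrAC mulr_sumr big_seq [leRHS]big_seq; apply: ler_sum => z zb.
  by rewrite mulrC ler_wpM2l ?kernel_ge0// half.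
rewrite (eq_bigr (fun z => 2 * \sum_(x <- Om) \sum_(y <- Om)
    kernel n x y * rmu mu (maps2 o x z y))) => [|z _]; last first.
  rewrite mulrCA mulr_sumr; congr (_ * _); apply: eq_bigr => x _.
  by rewrite mulr_sumr; apply: eq_bigr => y _; rewrite kernel_maps2.
rewrite -mulr_sumr -mulrA ler_wpM2l// exchange_big mulr_suml /=.
apply: ler_sum => x _; rewrite exchange_big mulr_suml /=; apply: ler_sum => y _.
by rewrite -mulr_sumr ler_wpM2l ?kernel_ge0// maps2_sum_le.
Qed.

End haar.

(** * The random walk *)

Section markov.
Context {R : realType} {V : choiceType} (E : rel V).
Hypothesis E_simple : simple_graph E.
Hypothesis E_locally_finite : locally_finite E.
Hypothesis E_connected : graph_connected E.
Hypothesis E_transitive : vertex_transitive E.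
Context {d : measure_display} {T : measurableType d} (Pr : probability T R).
Variable X : nat -> T -> V.
Hypothesis X_srw : simple_random_walk E Pr X.
Notation kernel := (@kernel V E R).

Definition cylinder (n : nat) (x : nat -> V) : set T :=
  [set w | forall i, (i <= n)%N -> X i w = x i].

Lemma measurable_state n x : measurable (X n @^-1` [set x]).
Proof. by have [] := X_srw. Qed.

Lemma measurable_cylinder n x : measurable (cylinder n x).
Proof.
have -> : cylinder n x = \bigcap_(i in `I_n.+1) (X i @^-1` [set x i]).
  by apply/seteqP; split => w H i /= /H.
by apply: fin_bigcap_measurable => // i _; exact: measurable_state.
Qed.

Lemma prob_finite (A : set T) : measurable A -> (Pr A < +oo)%E.
Proof. by move=> mA; apply: le_lt_trans (probability_le1 Pr mA) _; rewrite ltry. Qed.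

Lemma cylinder_step n x :
  rmu Pr (cylinder n.+1 x) = rmu Pr (cylinder n x) * srw_matrix R E (x n) (x n.+1).
Proof.
have [_ /(_ n x) step] := X_srw; rewrite /rmu.
transitivity (fine (Pr (cylinder n x) * (srw_matrix R E (x n) (x n.+1))%:E)%E).
  by congr fine; exact: step.
rewrite fineM//.
exact: fin_num_measure (measurable_cylinder n x).
Qed.

Definition extend (n : nat) (x : nat -> V) (z : V) : nat -> V :=
  fun i => if (i <= n)%N then x i else z.

Lemma cylinder_extend n x z :
  cylinder n.+1 (extend n x z) = cylinder n x `&` (X n.+1 @^-1` [set z]).
Proof.
apply/seteqP; split => w.
  move=> H; split=> [i le_in|].
    by have := H i (leqW le_in); rewrite /extend le_in.
  by have := H n.+1 (leqnn _); rewrite /extend ltnn.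
move=> [H /= Xz] i; rewrite leq_eqVlt /extend => /orP[/eqP ->|].
  by rewrite ltnn.
by rewrite ltnS => le_in; rewrite le_in; exact: H.
Qed.

Lemma cylinder_extend_mass n x z :
  rmu Pr (cylinder n.+1 (extend n x z)) = rmu Pr (cylinder n x) * srw_matrix R E (x n) z.
Proof.
rewrite cylinder_step (_ : cylinder n (extend n x z) = cylinder n x).
  by rewrite /extend leqnn ltnn.
by apply/seteqP; split => w H i le_in; have := H i le_in; rewrite /extend le_in.
Qed.

Lemma measurable_step_edge n (v : V) : measurable [set w | E v (X n w)].
Proof.
have -> : [set w | E v (X n w)] = \bigcup_(z in [set` nbr E v]) (X n @^-1` [set z]).
  apply/seteqP; split => w /=; first by move=> vX; exists (X n w); rewrite /= ?in_nbr.
  by move=> [z /=]; rewrite in_nbr// => vz ->.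
apply: fin_bigcup_measurable => [|z _]; first exact: finite_fset.
exact: measurable_state.
Qed.

(** The Markov property is stated for single trajectories; countability of the vertices upgrades it
    from each non-neighbour to all of them together. *)
Lemma cylinder_nonedge n x :
  Pr (cylinder n x `\` [set w | E (x n) (X n.+1 w)]) = 0%E.
Proof.
apply: measure_negligible.
  by apply: measurableD; [exact: measurable_cylinder|exact: measurable_step_edge].
have /countable_injP[f finj] := graph_countable E_locally_finite E_connected (x 0%N).
pose F j := [set w | cylinder n x w /\ ~~ E (x n) (X n.+1 w) /\ f (X n.+1 w) = j].
apply: (negligibleS (A := \bigcup_j F j)).
  by move=> w [Cw /negP nE]; exists (f (X n.+1 w)).
apply: negligible_bigcup => j.
have [[v [nEv fv]]|none] := pselect (exists v, ~~ E (x n) v /\ f v = j); last first.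
  apply: negligibleS (negligible_set0 Pr) => w [_ [nE fX]].
  by apply: none; exists (X n.+1 w).
exists (cylinder n.+1 (extend n x v)); split; first exact: measurable_cylinder.
  rewrite -[LHS]fineK ?fin_num_measure//; last exact: measurable_cylinder.
  rewrite -/(rmu Pr _) cylinder_extend_mass.
  by rewrite /srw_matrix (negbTE nEv) mulr0.
by move=> w [Cw [_ fX]]; rewrite cylinder_extend; split => //; apply: finj; rewrite ?inE// fv.
Qed.

(** Decomposition by the state at time [n.+1]. An upper bound is all that [stay_probability] asks
    for, so subadditivity is enough. *)
Lemma transition_le j n x y :
  rmu Pr (cylinder n x `&` (X (n + j) @^-1` [set y])) <=
  rmu Pr (cylinder n x) * kernel j (x n) y.
Proof.
elim: j n x => [|j IH] n x /=.
  rewrite addn0; have [<-|xy] := eqVneq (x n) y.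
    rewrite mulr1; apply: le_rmu; last exact: subIsetl.
    - by apply: measurableI; [exact: measurable_cylinder|exact: measurable_state].
    - exact: measurable_cylinder.
    - exact: prob_finite (measurable_cylinder n x).
  rewrite mulr0 (_ : _ `&` _ = set0) /rmu ?measure0//.
  apply/seteqP; split => // w [Cw /= Xy]; move/eqP: xy; apply.
  by rewrite -Xy (Cw n).
pose A := cylinder n x `&` (X (n + j.+1) @^-1` [set y]).
have mA : measurable A.
  by apply: measurableI; [exact: measurable_cylinder|exact: measurable_state].
(* [None] stands for the null event of a step along a non-edge; finitely many neighbours remain. *)
pose F (c : option V) : set T := if c is Some z
  then cylinder n.+1 (extend n x z) `&` (X (n.+1 + j) @^-1` [set y])
  else cylinder n x `\` [set w | E (x n) (X n.+1 w)].
have mF c : measurable (F c).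
  case: c => [z|] /=.
    by apply: measurableI; [exact: measurable_cylinder|exact: measurable_state].
  by apply: measurableD; [exact: measurable_cylinder|exact: measurable_step_edge].
have incl : A `<=` \bigcup_(c in [set` None :: map Some (nbr E (x n))]) F c.
  move=> w [Cw Xw]; have [xX|nX] := boolP (E (x n) (X n.+1 w)); last first.
    by exists None; [rewrite /= inE|split => //=; apply/negP].
  exists (Some (X n.+1 w)).
    by rewrite /= inE (mem_map (@Some_inj _)) in_nbr.
  by rewrite /F cylinder_extend addSnnS.
have [_] := rmu_subadditive mA mF (fun c => prob_finite (mF c)) incl.
have null : rmu Pr (F None) = 0 by exact: (congr1 fine (cylinder_nonedge n x)).
rewrite big_cons big_map null add0r => /le_trans; apply.
rewrite mulr_sumr; apply: ler_sum => z _; apply: le_trans (IH _ _) _.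
by rewrite cylinder_extend_mass {1}/extend ltnn mulrA.
Qed.

Lemma ball_kernel_const n r x y :
  \sum_(z <- ball E r x) kernel n x z = \sum_(z <- ball E r y) kernel n y z.
Proof.
have [g <-] := E_transitive x y.
rewrite ball_aut// big_imfset /=; last by move=> ? ? _ _; exact: aut_inj.
by apply: eq_bigr => z _; rewrite kernel_aut.
Qed.

(** The initial law is arbitrary: the event is split by the value of [X 0], and by transitivity each
    starting vertex gives the same ball sum. *)
Lemma stay_probability (o : V) k r :
  (Pr [set w | (graph_dist E (X 0%N w) (X k w) <= r)%N] <=
   (\sum_(z <- ball E r o) kernel k o z)%:E)%E.
Proof.
set q := \sum_(z <- _) _; have q0 : 0 <= q by apply: sumr_ge0 => z _; exact: kernel_ge0.
(* Numbering the vertices by [f] turns the partition by [X 0] into a sequence of events; an index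
   not taken by [f] gives an empty event. *)
have /countable_injP[f finj] := graph_countable E_locally_finite E_connected o.
pose A j := [set w | f (X 0%N w) = j].
pose S j := [set w | (graph_dist E (X 0%N w) (X k w) <= r)%N /\ f (X 0%N w) = j].
pose Sx x := (X 0%N @^-1` [set x]) `&` \bigcup_(y in [set` ball E r x]) (X k @^-1` [set y]).
have mSx x : measurable (Sx x).
  apply: measurableI; first exact: measurable_state.
  apply: fin_bigcup_measurable => [|y _]; first exact: finite_fset.
  exact: measurable_state.
have step j : [/\ measurable (A j), measurable (S j) & (Pr (S j) <= q%:E * Pr (A j))%E].
  have [[x fx]|none] := pselect (exists x, f x = j); last first.
    have -> : A j = set0 by apply/seteqP; split => // w Aw; apply: none; exists (X 0%N w).
    have -> : S j = set0 by apply/seteqP; split => // w [_ Aw]; apply: none; exists (X 0%N w).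
    by rewrite measure0 mule0.
  have AE : A j = X 0%N @^-1` [set x].
    apply/seteqP; split => w /=; last by rewrite /A /= => ->.
    by move=> Aw; apply: finj; rewrite ?inE// fx.
  have SE : S j = Sx x.
    apply/seteqP; split => w.
      move=> [dw]; rewrite -[_ = j]/(A j w) AE => Xx; split => //.
      exists (X k w) => //=; move: dw; rewrite Xx => dw.
      by rewrite -graph_dist_ball.
    move=> [/= Xx [y /= yb Xy]]; split; last by rewrite Xx.
    by rewrite Xx Xy graph_dist_ball.
  rewrite AE SE; split => //; first exact: measurable_state.
  pose F y := cylinder 0 (fun=> x) `&` (X (0 + k) @^-1` [set y]).
  have mF y : measurable (F y).
    by apply: measurableI; [exact: measurable_cylinder|exact: measurable_state].
  have cyl0 : cylinder 0 (fun=> x) = X 0%N @^-1` [set x].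
    apply/seteqP; split => w; first by move=> /(_ 0%N (leqnn _)).
    by move=> /= Xx i; rewrite leqn0 => /eqP ->.
  have incl : Sx x `<=` \bigcup_(y in [set` ball E r x]) F y.
    by move=> w [Xx [y yb Xy]]; exists y => //; rewrite /F cyl0.
  have [_ le1] := rmu_subadditive (mSx x) mF (fun y => prob_finite (mF y)) incl.
  rewrite (rmuE (prob_finite (mSx x))) (rmuE (prob_finite (measurable_state 0 x))).
  rewrite -EFinM lee_fin; apply: le_trans le1 _.
  rewrite /q (ball_kernel_const k r o x) mulr_suml; apply: ler_sum => y _.
  by rewrite mulrC -cyl0; exact: transition_le.
have -> : [set w | (graph_dist E (X 0%N w) (X k w) <= r)%N] = \bigcup_j S j.
  apply/seteqP; split => w; first by move=> dw; exists (f (X 0%N w)).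
  by move=> [j _ []].
have trivA : trivIset setT A by move=> i j _ _ [w [<- <-]].
rewrite measure_bigcup /=; last 2 first.
- by move=> j _; have [] := step j.
- by move=> i j _ _ [w [[_ <-] [_ <-]]].
apply: le_trans (_ : \sum_(j <oo) q%:E * Pr (A j) <= _)%E.
  under eq_eseriesl do rewrite in_setT.
  by apply: lee_nneseries => // j _; have [] := step j.
rewrite nneseriesZl//.
have -> : (\sum_(j <oo) Pr (A j) = 1)%E.
  rewrite -measure_semi_bigcup//; last 2 first.
  - by move=> j; have [] := step j.
  - by apply: bigcup_measurable => j _; have [] := step j.
  have -> : \bigcup_n A n = setT.
    by apply/seteqP; split => // w _; exists (f (X 0%N w)).
  exact: probability_setT.
by rewrite mule1.
Qed.

End markov.

(** * From ball return and spectral decay to the probability bound *)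

Lemma set_max_mem (A : set nat) : set_max A <> 0%N -> A (set_max A).
Proof. by rewrite /set_max; case: xgetP => [n _ []//|]. Qed.

Theorem theorem1p1 (R : realType) (V : choiceType) (E : rel V) (o : V)
    (E_simple : simple_graph E)
    (E_connected : graph_connected E)
    (E_locally_finite : locally_finite E)
    (E_transitive : vertex_transitive E)
    (E_unimodular : unimodular R E)
    (d : measure_display) (T : measurableType d) (Pr : probability T R)
    (X : nat -> T -> V) (X_srw : simple_random_walk E Pr X)
    (k r : nat) (k_ge1 : (1 <= k)%N) (r_ge1 : (1 <= r)%N) :
  (Pr [set w | (graph_dist E (X 0%N w) (X k w) <= r)%N] <=
   (2 * expR (- (ln 2 / 2
       * (max_exponent E (edge_constant R E o / r%:R) k)%:R)))%:E)%E.
Proof.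
set L := max_exponent _ _ _.
apply: le_trans (stay_probability E_locally_finite E_connected
  E_transitive X_srw o k r) _.
(* Exponents up to [2], among them the default [0], give a trivial bound. *)
rewrite lee_fin; have [L_le2|L_ge3] := leqP L 2.
  apply: le_trans (small_exponent L_le2).
  exact: kernel_sum_le1.
(* Without neighbours, the kernel at a time [k >= 1] is an empty sum. *)
have [d0|dN0] := eqVneq (degree E o) 0%N.
  rewrite big1 ?mulr_ge0 ?expR_ge0// => z _.
  rewrite -(prednK k_ge1) /= (cardfs0_eq _ : nbr E o = fset0) ?big_seq_fset0//.
have deg0 : (0 < degree E o)%N by rewrite lt0n.
have [t [Et LA]] : exists t,
    decr_inv (isoperimetric_profile (srw_matrix R E)) (edge_constant R E o / r%:R) = t%:E
    /\ ((L%:R * ln 2)%:E / spectral_profile (srw_matrix R E) (2 ^+ L.+1 * t)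
        <= k%:R%:E)%E.
  move: L_ge3; rewrite /L /max_exponent; case: decr_inv => [t| |] //.
  set A := [set l : nat | _] => A3; exists t; split => //.
  (* A value of at least [3] is not the default [0], so it belongs to the set. *)
  by apply: (@set_max_mem A) => A0; rewrite A0 in A3.
have [Om [Om0 Omt bdOm]] := decr_inv_isoperimetric E_locally_finite E_transitive o Et.
have Om_gt0 : 0 < #|` Om|%:R :> R by rewrite ltr0n cardfs_gt0.
have r0 : 0 < r%:R :> R by rewrite ltr0n.
have D0 : 0 < (degree E o)%:R :> R by rewrite ltr0n.
(* The reason for the form of [edge_constant]: times the degree, it is half the minimal orbit
   size. *)
have small : 2 * r%:R * (boundary_size E Om)%:R <= (min_orbit_size E o)%:R * #|` Om|%:R :> R.
  apply: le_trans (ler_wpM2l _ bdOm) _; first by rewrite mulr_ge0.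
  have rV : r%:R^-1 * r%:R = 1 :> R by rewrite mulVf ?gt_eqF.
  have DV : (degree E o)%:R^-1 * (degree E o)%:R = 1 :> R by rewrite mulVf ?gt_eqF.
  rewrite /edge_constant le_eqVlt; apply/orP; left; apply/eqP.
  transitivity ((min_orbit_size E o)%:R * #|` Om|%:R * (r%:R^-1 * r%:R)
     * ((degree E o)%:R^-1 * (degree E o)%:R) : R); last by rewrite rV DV !mulr1.
  by rewrite invfM; lra.
have [mu [mu_left mu_right]] := E_unimodular.
have H1 := ball_return E_locally_finite E_connected E_transitive mu_left mu_right
  k (min_orbit_size_gt0 E_locally_finite E_transitive deg0) small.
have H2 := kernel_return_bound E_simple E_locally_finite E_transitive L_ge3 Om0 Omt LA.
rewrite -(ler_pM2l Om_gt0); apply: le_trans H1 _.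
by rewrite [leRHS]mulrCA; apply: ler_wpM2l.
Qed.
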